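(* Let $\mathbf{k}$ be an algebraically closed field of characteristic $0$, let $\delta$ be a finite-dimensional Lie algebra over $\mathbf{k}$, and let $H=U(\delta)$ be its universal enveloping algebra with coproduct $\Delta$. Then the solutions $\alpha\in H\otimes H$ of the equation $$(\alpha\otimes1)(\Delta\otimes \mathrm{id})\alpha-(1\otimes\alpha)(\mathrm{id}\otimes\Delta)\alpha=(\sigma\otimes \mathrm{id})\bigl[(\alpha\otimes1)(\Delta\otimes \mathrm{id})\alpha-(1\otimes\alpha)(\mathrm{id}\otimes\Delta)\alpha\bigr]$$ in $H\otimes H\otimes H$ are exactly the elements $\alpha=1\otimes s+t\otimes1$ with $s\in\delta$ and $t\in\mathbf{k}$ arbitrary.
   Context: $H=U(\delta)$ carries its standard cocommutative Hopf algebra structure, with $\Delta(x)=x\otimes1+1\otimes x$ for $x\in\delta$. We regard $\mathbf{k}\subset H$ and $\delta\subset H$. Tensor products are over $\mathbf{k}$, and products in $H^{\otimes n}$ are componentwise. $\sigma:H\otimes H\to H\otimes H$ is the flip $\sigma(f\otimes g)=g\otimes f$. *)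

(* Defs.v *)
From HB Require Import structures.
From mathcomp Require Import all_boot all_algebra.
From mathcomp Require Import boolp classical_sets.
From mathcomp Require Import finmap freeg monalg.

Set Implicit Arguments.
Unset Strict Implicit.
Unset Printing Implicit Defensive.

Import GRing.Theory.
Local Open Scope ring_scope.
Local Open Scope quotient_scope.

Local Notation "<< p >>" := [freeg [:: (1, p)]] : ring_scope.

Section LmodQuotient.
Variables (R : pzRingType) (V : lmodType R) (S : V -> Prop).

Inductive lspan : V -> Prop :=
| lspan0 : lspan 0
| lspan_gen v : S v -> lspan v
| lspanP a u v : lspan u -> lspan v -> lspan (a *: u + v).

Definition in_lspan : {pred V} := fun v => `[< lspan v >].

Lemma in_lspan_submod_closed : submod_closed in_lspan.
Proof.
split; first by apply/asboolP; exact: lspan0.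
by move=> a u v /asboolP hu /asboolP hv; apply/asboolP; exact: lspanP.
Qed.

HB.instance Definition _ :=
  GRing.isSubmodClosed.Build R V in_lspan in_lspan_submod_closed.

Definition lquot : Type := Quotient.quot (in_lspan : zmodClosed V).

HB.instance Definition _ := GRing.Zmodule.copy lquot (Quotient.quot (in_lspan : zmodClosed V)).

Definition lpi (v : V) : lquot := \pi v.

Lemma lpi_eqP u v : lpi u = lpi v <-> lspan (u - v).
Proof.
have -> : (lpi u = lpi v) <-> (lpi u == lpi v) by split => /eqP.
by rewrite /lpi -Quotient.idealrBE; split => /asboolP.
Qed.

Lemma lpi_repr (x : lquot) : lpi (repr x) = x.
Proof. by rewrite /lpi reprK. Qed.

Lemma lpi_surj (x : lquot) : exists v, x = lpi v.
Proof. by exists (repr x); rewrite lpi_repr. Qed.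

Lemma lpiB : {morph lpi : u v / u - v}.
Proof. by move=> u v; rewrite /lpi !piE. Qed.

Lemma lpiD : {morph lpi : u v / u + v}.
Proof. by move=> u v; rewrite /lpi !piE. Qed.

Lemma lpi_gen v : S v -> lpi v = lpi 0.
Proof. by move=> Sv; apply/lpi_eqP; rewrite subr0; apply: lspan_gen. Qed.

Definition lscale (a : R) (x : lquot) : lquot := lpi (a *: repr x).

Lemma lscaleE a v : lscale a (lpi v) = lpi (a *: v).
Proof.
rewrite /lscale; apply/lpi_eqP; rewrite -scalerBr -[a *: _]addr0; apply: lspanP; last exact: lspan0.
by apply/lpi_eqP; rewrite lpi_repr.
Qed.

Fact lscaleA a b x : lscale a (lscale b x) = lscale (a * b) x.
Proof. by have [v ->] := lpi_surj x; rewrite !lscaleE scalerA. Qed.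
Fact lscale1 : left_id 1 lscale.
Proof. by move=> x; have [v ->] := lpi_surj x; rewrite lscaleE scale1r. Qed.
Fact lscaleDr : right_distributive lscale +%R.
Proof.
move=> a x y; have [[u ->] [v ->]] := (lpi_surj x, lpi_surj y).
by rewrite -lpiD !lscaleE scalerDr lpiD.
Qed.
Fact lscaleDl x : {morph lscale^~ x : a b / a + b}.
Proof.
by move=> a b; have [u ->] := lpi_surj x; rewrite !lscaleE scalerDl lpiD.
Qed.

HB.instance Definition _ := GRing.Zmodule_isLmodule.Build R lquot
  lscaleA lscale1 lscaleDr lscaleDl.

Lemma lpiP : linear lpi.
Proof. by move=> a u v; rewrite lpiD -lscaleE. Qed.

HB.instance Definition _ := GRing.isLinear.Build R V lquot *:%R lpi lpiP.

End LmodQuotient.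

(* Only used to show that the unit of A ⊗ B is nonzero, which nzRingType
   requires; A and B may be infinite-dimensional, hence Zorn's lemma. *)
Section NormalizedForm.
Variables (k : fieldType) (V : lmodType k) (v : V).
Hypothesis v_neq0 : v <> 0.

Lemma exists_hyperplane : exists W : set V,
  [/\ W 0, forall a u w, W u -> W w -> W (a *: u + w), ~ W v &
      forall u, exists c, W (u - c *: v)].
Proof.
pose P (W : set V) := (forall a u w, W u -> W w -> W (a *: u + w)) /\ ~ W v.
have [F FP Ft|W [[Wl Wv] Wmax]] := @Zorn_bigcup V P.
  split=> [a u w [X FX Xu] [Y FY Yw]|[X /FP[_ ]] //].
  have [XY|YX] := Ft _ _ FX FY.
    by exists Y => //; apply: (FP _ FY).1 => //; apply: XY.
  by exists X => //; apply: (FP _ FX).1 => //; apply: YX.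
have W0 : W 0.
  have [[w Ww]|W_empty] := pselect (exists w, W w).
    by have := Wl (-1) _ _ Ww Ww; rewrite scaleN1r addNr.
  exfalso; apply: (Wmax [set 0]%classic); last first.
    by split=> [a u w -> ->|/=]; [rewrite /= scaler0 addr0 | move/v_neq0].
  split=> [w Ww|]; first by case: W_empty; exists w.
  by move=> /(_ 0 erefl) W0; apply: W_empty; exists 0.
exists W; split=> // u.
have [Wu|nWu] := pselect (W u); first by exists 0; rewrite scale0r subr0.
pose W' : set V := fun x => exists c w, W w /\ x = c *: u + w.
have [c [w [Ww vE]]] : W' v.
  have [//|nW'v] := pselect (W' v).
  exfalso; apply: (Wmax W'); last first.
    split=> // a x y [c [w [Ww ->]]] [d [w' [Ww' ->]]].
    exists (a * c + d), (a *: w + w'); split; first exact: Wl.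
    by rewrite scalerDr scalerA scalerDl addrACA.
  split=> [w Ww|]; first by exists 0, w; rewrite scale0r add0r.
  move=> /(_ u) WW; apply/nWu/WW; exists 1, 0; split=> //.
  by rewrite scale1r addr0.
have c0 : c != 0.
  by apply/eqP => c0; apply: Wv; rewrite vE c0 scale0r add0r.
exists c^-1; rewrite vE scalerDr scalerA mulVf // scale1r opprD addNKr.
by rewrite -scalerN -[X in W X]addr0 scalerN -scaleNr; apply: Wl.
Qed.

Lemma exists_normalized_form : exists f : V -> k^o, linear f /\ f v = 1.
Proof.
have [W [W0 Wl Wv WS]] := exists_hyperplane.
have [f fP] := choice WS.
have WB x y : W x -> W y -> W (x - y).
  by move=> Wx Wy; rewrite addrC -scaleN1r; apply: Wl.
have Wc c : W (c *: v) -> c = 0.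
  move=> Wc; apply/eqP/negPn/negP => c0; apply: Wv.
  by rewrite -[v](scalerK c0) -[X in W X]addr0; apply: Wl.
have uniq_c u c : W (u - c *: v) -> f u = c.
  move=> Wu; apply/eqP; rewrite -subr_eq0; apply/eqP/Wc.
  have := WB _ _ Wu (fP u); rewrite scalerBl.
  by rewrite opprD opprK addrA [_ - u]addrC addrA addNr sub0r addrC.
exists f; split=> [a u w|]; last by apply: uniq_c; rewrite scale1r subrr.
apply: uniq_c; have := Wl a _ _ (fP u) (fP w).
by rewrite scalerBr scalerA addrACA -opprD -scalerDl.
Qed.

End NormalizedForm.

Section TQ.
Variables (k : fieldType) (A B : algType k).

Inductive bilin_rel : {freeg (A * B)%type / k} -> Prop :=
| bilin_rel_l c a a' b :
    bilin_rel (<< (c *: a + a', b) >> - (c *: << (a, b) >> + << (a', b) >>))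
| bilin_rel_r c a b b' :
    bilin_rel (<< (a, c *: b + b') >> - (c *: << (a, b) >> + << (a, b') >>)).

Definition tq : Type := lquot bilin_rel.

HB.instance Definition _ := GRing.Lmodule.copy tq (lquot bilin_rel).

Definition tq_pure (a : A) (b : B) : tq := lpi bilin_rel << (a, b) >>.

Lemma tq_purePl c a a' b : tq_pure (c *: a + a') b = c *: tq_pure a b + tq_pure a' b.
Proof.
rewrite /tq_pure -linearP; apply/lpi_eqP; apply: lspan_gen.
exact: bilin_rel_l.
Qed.

Lemma tq_purePr c a b b' : tq_pure a (c *: b + b') = c *: tq_pure a b + tq_pure a b'.
Proof.
rewrite /tq_pure -linearP; apply/lpi_eqP; apply: lspan_gen.
exact: bilin_rel_r.
Qed.

Lemma tq_ind (P : tq -> Prop) :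
  P 0 -> (forall c a b x, P x -> P (c *: tq_pure a b + x)) -> forall x, P x.
Proof.
move=> P0 PD x; have [v ->] := lpi_surj x; rewrite -[v]freeg_sumE.
elim: (dom v) => [|p s IH]; first by rewrite big_nil linear0.
rewrite big_cons; case: p => a b.
suff -> : [freeg [:: (coeff (a, b) v, (a, b))]] = coeff (a, b) v *: << (a, b) >>.
  by rewrite linearP; exact: PD.
by apply/eqP/freeg_eqP => z; rewrite coeffZ !coeffU mul1r.
Qed.

End TQ.

(* Evaluated on a representative: well defined only when f is bilinear. *)
Definition tq_lift (k : fieldType) (A B : algType k)
    (W : lmodType k) (f : A -> B -> W) (x : tq A B) : W :=
  fglift (fun p : A * B => f p.1 p.2) (repr x).

Section TQLift.
Variables (k : fieldType) (A B : algType k) (W : lmodType k).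
Variable f : A -> B -> W.
Hypotheses (fl : forall b, linear (f^~ b)) (fr : forall a, linear (f a)).

Local Notation bilin_rel := (@bilin_rel k A B).

Let F := fglift (fun p : A * B => f p.1 p.2).

Fact fglift_linear : linear F.
Proof.
have FB : {morph F : u v / u - v} by apply: lift_is_additive.
have F0 : F 0 = 0 by rewrite -(subrr (0 : {freeg (A * B)%type / k})) FB subrr.
have FN : {morph F : u / - u} by move=> u; rewrite -sub0r FB F0 sub0r.
have FD : {morph F : u v / u + v}.
  by move=> u v; rewrite -[v in LHS]opprK FB FN opprK.
move=> c u v; rewrite FD; congr (_ + _).
rewrite -[u]freeg_sumE scaler_sumr !(big_morph F FD F0) scaler_sumr.
apply: eq_bigr => p _.
have -> : c *: [freeg [:: (coeff p u, p)]] = [freeg [:: (c * coeff p u, p)]].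
  by apply/eqP/freeg_eqP => z; rewrite coeffZ !coeffU mulrA.
by rewrite /F !liftU scalerA.
Qed.

Fact fglift_span v : lspan bilin_rel v -> F v = 0.
Proof.
have Fl := fglift_linear.
have F0 : F 0 = 0 by have := Fl (-1) 0 0; rewrite scaler0 addr0 scaleN1r addNr.
have FB u w : F (u - w) = F u - F w.
  have -> : u - w = (-1) *: w + u by rewrite scaleN1r addrC.
  by rewrite Fl scaleN1r addrC.
elim=> [|_ [c a a' b|c a b b']|c u w _ Hu _ Hw] //.
- by rewrite FB Fl /F !liftU !scale1r /= fl subrr.
- by rewrite FB Fl /F !liftU !scale1r /= fr subrr.
- by rewrite Fl Hu Hw scaler0 addr0.
Qed.

Lemma tq_lift_lpi v : tq_lift f (lpi bilin_rel v) = F v.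
Proof.
have Fl := fglift_linear.
rewrite /tq_lift -/F; suff : F (repr (lpi bilin_rel v) - v) = 0.
  have -> : repr (lpi bilin_rel v) - v = (-1) *: v + repr (lpi bilin_rel v).
    by rewrite scaleN1r addrC.
  by rewrite Fl scaleN1r addrC => /subr0_eq.
by apply: fglift_span; apply/lpi_eqP; rewrite lpi_repr.
Qed.

Lemma tq_lift_linear : linear (tq_lift f).
Proof.
move=> c x y; have [[u ->] [v ->]] := (lpi_surj x, lpi_surj y).
by rewrite -[c *: _ + _](linearP (lpi bilin_rel)) !tq_lift_lpi fglift_linear.
Qed.

Lemma tq_liftE a b : tq_lift f (tq_pure a b) = f a b.
Proof. by rewrite tq_lift_lpi /F liftU scale1r. Qed.

End TQLift.

Local Notation "a ⊠ b" := (tq_pure a b) (at level 40, left associativity).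

Lemma tq_ext (k : fieldType) (A B : algType k) (W : lmodType k)
    (f g : tq A B -> W) :
  linear f -> linear g -> (forall a b, f (a ⊠ b) = g (a ⊠ b)) -> f =1 g.
Proof.
have lin0 (h : tq A B -> W) : linear h -> h 0 = 0.
  by move=> hl; have := hl (-1) 0 0; rewrite scaler0 addr0 scaleN1r addNr.
move=> fl gl fg; elim/tq_ind => [|c a b x IH]; first by rewrite !lin0.
by rewrite fl gl fg IH.
Qed.

Definition tq_mul (k : fieldType) (A B : algType k)
    (x y : tq A B) : tq A B :=
  tq_lift (fun a b => tq_lift (fun a' b' => (a * a') ⊠ (b * b')) y) x.

Section TQAlgebra.
Variables (k : fieldType) (A B : algType k).

Local Notation tq_mul := (@tq_mul k A B).

Let inner (a : A) (b : B) : tq A B -> tq A B :=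
  tq_lift (fun a' b' => (a * a') ⊠ (b * b')).

Fact inner_l a b b' : linear (fun a' : A => (a * a') ⊠ ((b * b') : B)).
Proof. by move=> c x y; rewrite mulrDr -scalerAr tq_purePl. Qed.
Fact inner_r a b a' : linear (fun b' : B => ((a * a') : A) ⊠ (b * b')).
Proof. by move=> c x y; rewrite mulrDr -scalerAr tq_purePr. Qed.
Fact inner_linear a b : linear (inner a b).
Proof. exact: (tq_lift_linear (inner_l a b) (inner_r a b)). Qed.
Fact innerE a b a' b' : inner a b (a' ⊠ b') = (a * a') ⊠ (b * b').
Proof. exact: (tq_liftE (inner_l a b) (inner_r a b)). Qed.

Fact outer_l y b : linear (fun a => inner a b y).
Proof.
move=> c a a'; move: y; apply: tq_ext => [|s x y|a'' b''].
- exact: inner_linear.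
- by rewrite !inner_linear !scalerDr !scalerA [s * c]mulrC addrACA.
by rewrite !innerE mulrDl -scalerAl tq_purePl.
Qed.
Fact outer_r y a : linear (fun b => inner a b y).
Proof.
move=> c b b'; move: y; apply: tq_ext => [|s x y|a'' b''].
- exact: inner_linear.
- by rewrite !inner_linear !scalerDr !scalerA [s * c]mulrC addrACA.
by rewrite !innerE mulrDl -scalerAl tq_purePr.
Qed.

Fact tq_mul_linear_l y : linear (tq_mul^~ y).
Proof. by rewrite /tq_mul; exact: (tq_lift_linear (outer_l y) (outer_r y)). Qed.
Fact tq_mul_tens_l a b y : tq_mul (a ⊠ b) y = inner a b y.
Proof. by rewrite /tq_mul; exact: (tq_liftE (outer_l y) (outer_r y)). Qed.
Fact tq_mul_linear_r x : linear (tq_mul x).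
Proof.
move=> c y z; move: x; apply: tq_ext => [|s x x'|a b].
- exact: tq_mul_linear_l.
- by rewrite !tq_mul_linear_l !scalerDr !scalerA [s * c]mulrC addrACA.
by rewrite !tq_mul_tens_l inner_linear.
Qed.
Fact tq_mulE a b a' b' : tq_mul (a ⊠ b) (a' ⊠ b') = (a * a') ⊠ (b * b').
Proof. by rewrite tq_mul_tens_l innerE. Qed.

Fact tq_mulA : associative tq_mul.
Proof.
move=> x y z; move: x; apply: tq_ext => [c x x'|c x x'|a b].
- by rewrite tq_mul_linear_l.
- by rewrite !tq_mul_linear_l.
move: y; apply: tq_ext => [c y y'|c y y'|a' b'].
- by rewrite tq_mul_linear_l tq_mul_linear_r.
- by rewrite tq_mul_linear_r tq_mul_linear_l.
move: z; apply: tq_ext => [c z z'|c z z'|a'' b''].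
- by rewrite !tq_mul_linear_r.
- by rewrite !tq_mul_linear_r.
by rewrite !tq_mulE !mulrA.
Qed.
Fact tq_mul1l : left_id (1 ⊠ 1) tq_mul.
Proof.
apply: tq_ext => [||a b]; first exact: tq_mul_linear_r.
  by [].
by rewrite tq_mulE !mul1r.
Qed.
Fact tq_mul1r : right_id (1 ⊠ 1) tq_mul.
Proof.
apply: tq_ext => [||a b]; first exact: tq_mul_linear_l.
  by [].
by rewrite tq_mulE !mulr1.
Qed.
Fact tq_mulDl : left_distributive tq_mul +%R.
Proof. by move=> x y z; have := tq_mul_linear_l z 1 x y; rewrite !scale1r. Qed.
Fact tq_mulDr : right_distributive tq_mul +%R.
Proof. by move=> x y z; have := tq_mul_linear_r x 1 y z; rewrite !scale1r. Qed.
Fact tq_one_neq0 : 1 ⊠ 1 != 0 :> tq A B.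
Proof.
have [f [fl f1]] := @exists_normalized_form k A 1 (elimN eqP (oner_neq0 A)).
have [g [gl g1]] := @exists_normalized_form k B 1 (elimN eqP (oner_neq0 B)).
pose h (a : A) (b : B) : k^o := f a * g b.
have hl b : linear (h^~ b).
  by move=> c a a'; rewrite /h fl mulrDl -scalerAl.
have hr a : linear (h a).
  by move=> c b b'; rewrite /h gl mulrDr -scalerAr.
apply/eqP => /(congr1 (tq_lift h)); rewrite tq_liftE // /h f1 g1 mulr1.
have := tq_lift_linear hl hr (-1) 0 0; rewrite scaler0 addr0 scaleN1r addNr => ->.
by move/eqP; rewrite oner_eq0.
Qed.

HB.instance Definition _ := GRing.Zmodule_isNzRing.Build (tq A B)
  tq_mulA tq_mul1l tq_mul1r tq_mulDl tq_mulDr tq_one_neq0.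

Fact tq_scaleAl (c : k) (x y : tq A B) : c *: (x * y) = (c *: x) * y.
Proof.
rewrite -[RHS]/(tq_mul (c *: x) y) -[c *: x]addr0 tq_mul_linear_l.
by rewrite -[tq_mul 0 y]/(0 * y) mul0r addr0.
Qed.
Fact tq_scaleAr (c : k) (x y : tq A B) : c *: (x * y) = x * (c *: y).
Proof.
rewrite -[RHS]/(tq_mul x (c *: y)) -[c *: y]addr0 tq_mul_linear_r.
by rewrite -[tq_mul x 0]/(x * 0) mulr0 addr0.
Qed.

HB.instance Definition _ :=
  GRing.Lmodule_isLalgebra.Build k (tq A B) tq_scaleAl.
HB.instance Definition _ :=
  GRing.Lalgebra_isAlgebra.Build k (tq A B) tq_scaleAr.

Lemma tq_pureM (a a' : A) (b b' : B) :
  (a ⊠ b) * (a' ⊠ b') = (a * a') ⊠ (b * b').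
Proof. exact: tq_mulE. Qed.

Lemma tq_pure11 : 1 ⊠ 1 = 1 :> tq A B.
Proof. by []. Qed.

End TQAlgebra.

Record tensor_model (k : fieldType) (A B : algType k) := TensorModel {
  tm_alg : algType k;
  tm_tens : A -> B -> tm_alg;
  tm_lift : forall W : lmodType k, (A -> B -> W) -> tm_alg -> W;
  tm_tensPl : forall b, linear (tm_tens^~ b);
  tm_tensPr : forall a, linear (tm_tens a);
  tm_liftP : forall (W : lmodType k) (f : A -> B -> W),
    (forall b, linear (f^~ b)) -> (forall a, linear (f a)) ->
    linear (tm_lift f) /\ (forall a b, tm_lift f (tm_tens a b) = f a b);
  tm_ext : forall (W : lmodType k) (f g : tm_alg -> W),
    linear f -> linear g ->
    (forall a b, f (tm_tens a b) = g (tm_tens a b)) -> f =1 g;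
  tm_tens1 : tm_tens 1 1 = 1;
  tm_tensM : forall a a' b b',
    tm_tens a b * tm_tens a' b' = tm_tens (a * a') (b * b')
}.

(* Bundled with its universal property and locked: everything below uses only
   the record fields, and unification never unfolds the quotient. *)
HB.lock Definition tensor_product (k : fieldType) (A B : algType k) :
    tensor_model A B :=
  @TensorModel k A B (tq A B) (@tq_pure k A B) (@tq_lift k A B)
    (fun b c a a' => tq_purePl c a a' b) (fun a c b b' => tq_purePr c a b b')
    (fun W f fl fr => conj (tq_lift_linear fl fr) (tq_liftE fl fr))
    (@tq_ext k A B) (@tq_pure11 k A B) (@tq_pureM k A B).

Definition tensor (k : fieldType) (A B : algType k) : algType k :=
  tm_alg (tensor_product A B).

Definition tens (k : fieldType) (A B : algType k) :
  A -> B -> tensor A B := @tm_tens k A B (tensor_product A B).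

Definition tlift (k : fieldType) (A B : algType k) (W : lmodType k)
    (f : A -> B -> W) : tensor A B -> W :=
  @tm_lift k A B (tensor_product A B) W f.

Notation "A ⊗[ k ] B" := (@tensor k A B)
  (at level 40, left associativity, format "A  ⊗[ k ]  B") : type_scope.
Notation "a ⊗ b" := (tens a b)
  (at level 40, left associativity) : ring_scope.

Section TensorTheory.
Variables (k : fieldType) (A B : algType k).

Lemma tensPl (b : B) : linear (fun a : A => a ⊗ b).
Proof. exact: tm_tensPl. Qed.

Lemma tensPr (a : A) : linear (fun b : B => a ⊗ b).
Proof. exact: tm_tensPr. Qed.

Lemma tlift_linear (W : lmodType k) (f : A -> B -> W) :
  (forall b, linear (f^~ b)) -> (forall a, linear (f a)) -> linear (tlift f).
Proof. by move=> fl fr; exact: (tm_liftP _ fl fr).1. Qed.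

Lemma tliftE (W : lmodType k) (f : A -> B -> W) :
  (forall b, linear (f^~ b)) -> (forall a, linear (f a)) ->
  forall a b, tlift f (a ⊗ b) = f a b.
Proof. by move=> fl fr; exact: (tm_liftP _ fl fr).2. Qed.

Lemma tensor_linear_ext (W : lmodType k) (f g : A ⊗[k] B -> W) :
  linear f -> linear g -> (forall a b, f (a ⊗ b) = g (a ⊗ b)) -> f =1 g.
Proof. exact: tm_ext. Qed.

Lemma tens11 : 1 ⊗ 1 = 1 :> A ⊗[k] B.
Proof. exact: tm_tens1. Qed.

Lemma tensM (a a' : A) (b b' : B) :
  (a ⊗ b) * (a' ⊗ b') = (a * a') ⊗ (b * b').
Proof. exact: tm_tensM. Qed.

End TensorTheory.

Definition tmap (k : fieldType) (A B C D : algType k)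
    (f : {linear A -> C}) (g : {linear B -> D}) : A ⊗[k] B -> C ⊗[k] D :=
  tlift (fun a b => f a ⊗ g b).

Definition tflip (k : fieldType) (A B : algType k) : A ⊗[k] B -> B ⊗[k] A :=
  tlift (fun a b => b ⊗ a).

(* A ⊗ B ⊗ C is (A ⊗ B) ⊗ C; tassoc carries elements of A ⊗ (B ⊗ C), such as
   1 ⊗ x or (id ⊗ f) y, to that bracketing. *)
Definition tassoc (k : fieldType) (A B C : algType k) :
    A ⊗[k] (B ⊗[k] C) -> (A ⊗[k] B) ⊗[k] C :=
  tlift (fun a => tlift (fun b c => a ⊗ b ⊗ c)).

Section TensorMaps.
Variables (k : fieldType) (A B C D : algType k).

Section Tmap.
Variables (f : {linear A -> C}) (g : {linear B -> D}).

Fact tmap_bilin_l b : linear (fun a => f a ⊗ g b).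
Proof. by move=> c a a'; rewrite linearP tensPl. Qed.
Fact tmap_bilin_r a : linear (fun b => f a ⊗ g b).
Proof. by move=> c b b'; rewrite linearP tensPr. Qed.

Lemma tmapE a b : tmap f g (a ⊗ b) = f a ⊗ g b.
Proof. by rewrite /tmap; exact: (tliftE tmap_bilin_l tmap_bilin_r). Qed.

Lemma tmap_linear : linear (tmap f g).
Proof. by rewrite /tmap; exact: (tlift_linear tmap_bilin_l tmap_bilin_r). Qed.

HB.instance Definition _ :=
  GRing.isLinear.Build k (A ⊗[k] B) (C ⊗[k] D) *:%R (tmap f g) tmap_linear.
End Tmap.

Fact tflip_bilin_l (b : B) : linear (fun a : A => b ⊗ a).
Proof. by move=> c a a'; rewrite tensPr. Qed.
Fact tflip_bilin_r (a : A) : linear (fun b : B => b ⊗ a).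
Proof. by move=> c b b'; rewrite tensPl. Qed.

Lemma tflipE (a : A) (b : B) : tflip (a ⊗ b) = b ⊗ a.
Proof. by rewrite /tflip; exact: (tliftE tflip_bilin_l tflip_bilin_r). Qed.

Lemma tflip_linear : linear (@tflip k A B).
Proof. by rewrite /tflip; exact: (tlift_linear tflip_bilin_l tflip_bilin_r). Qed.

HB.instance Definition _ :=
  GRing.isLinear.Build k (A ⊗[k] B) (B ⊗[k] A) *:%R (@tflip k A B) tflip_linear.

Fact tassoc_in_l (a : A) (c : C) : linear (fun b : B => a ⊗ b ⊗ c).
Proof. by move=> t b b'; rewrite tensPr tensPl. Qed.
Fact tassoc_in_r (a : A) (b : B) : linear (fun c : C => a ⊗ b ⊗ c).
Proof. by move=> t c c'; rewrite tensPr. Qed.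

Fact tassoc_bilin_r (a : A) : linear (tlift (fun (b : B) (c : C) => a ⊗ b ⊗ c)).
Proof. exact: (tlift_linear (tassoc_in_l a) (tassoc_in_r a)). Qed.

Fact tassoc_bilin_l (x : B ⊗[k] C) :
  linear (fun a : A => tlift (fun (b : B) (c : C) => a ⊗ b ⊗ c) x).
Proof.
move=> t a a'; move: x; apply: tensor_linear_ext.
- exact: tassoc_bilin_r.
- by move=> s x y; rewrite !tassoc_bilin_r !scalerDr !scalerA [s * t]mulrC addrACA.
move=> b c; rewrite !(tliftE (tassoc_in_l _) (tassoc_in_r _)).
by rewrite !tensPl.
Qed.

Lemma tassocE (a : A) (b : B) (c : C) : tassoc (a ⊗ (b ⊗ c)) = a ⊗ b ⊗ c.
Proof.
rewrite /tassoc (tliftE tassoc_bilin_l tassoc_bilin_r).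
exact: (tliftE (tassoc_in_l _) (tassoc_in_r _)).
Qed.

Lemma tassoc_linear : linear (@tassoc k A B C).
Proof. by rewrite /tassoc; exact: (tlift_linear tassoc_bilin_l tassoc_bilin_r). Qed.

HB.instance Definition _ :=
  GRing.isLinear.Build k (A ⊗[k] (B ⊗[k] C)) ((A ⊗[k] B) ⊗[k] C) *:%R
    (@tassoc k A B C) tassoc_linear.

End TensorMaps.

Lemma tassocM (k : fieldType) (A B C : algType k) (x y : A ⊗[k] (B ⊗[k] C)) :
  tassoc (x * y) = tassoc x * tassoc y.
Proof.
have mulP (T : algType k) (c : k) (u v w : T) :
    ((c *: u + v) * w = c *: (u * w) + v * w) *
    (w * (c *: u + v) = c *: (w * u) + w * v).
  by rewrite mulrDl mulrDr -scalerAl -scalerAr.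
move: x; apply: tensor_linear_ext => [c x x'|c x x'|a].
- by rewrite mulP linearP.
- by rewrite linearP mulP.
apply: tensor_linear_ext => [c z z'|c z z'|b d].
- by rewrite tensPr mulP linearP.
- by rewrite tensPr linearP mulP.
move: y; apply: tensor_linear_ext => [c y y'|c y y'|a'].
- by rewrite mulP linearP.
- by rewrite linearP mulP.
apply: tensor_linear_ext => [c z z'|c z z'|b' d'].
- by rewrite tensPr mulP linearP.
- by rewrite tensPr linearP mulP.
by rewrite !tensM !tassocE !tensM.
Qed.

Lemma malgUZ (R : nzRingType) (K : choiceType) (c a : R) (x : K) :
  << c * a *g x >> = c *: << a *g x >>.
Proof. by apply/malgP => y; rewrite mcoeffZ !mcoeffU mulrnAr. Qed.

Definition fa (k : fieldType) (I : choiceType) : Type :=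
  {malg k[{fmonom I}]}.

Section FreeAlgebra.
Variables (k : fieldType) (I : choiceType).

HB.instance Definition _ :=
  GRing.Lalgebra.copy (fa k I) {malg k[{fmonom I}]}.

Fact fa_scaleAr (c : k) (x y : {malg k[{fmonom I}]}) :
  c *: (x * y) = x * (c *: y).
Proof.
rewrite [RHS]malgME [x * y]malgME scaler_sumr; apply: eq_bigr => m _.
rewrite scaler_sumr (big_fset_incl _ (msuppZ_le c y)) /=; last first.
  by move=> m' _ /mcoeff_outdom ->; rewrite mulr0 monalgU0.
by apply: eq_bigr => m' _; rewrite mcoeffZ mulrCA -malgUZ.
Qed.

HB.instance Definition _ :=
  GRing.Lalgebra_isAlgebra.Build k (fa k I) fa_scaleAr.

End FreeAlgebra.

Definition fa_var (k : fieldType) (I : choiceType) (i : I) :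
  fa k I := << 1 *g fmu i >>.

Definition fmonom_eval (k : fieldType) (I : choiceType) (B : algType k)
  (f : I -> B) (m : {fmonom I}) : B := \prod_(i <- m) f i.

Definition fa_lift (k : fieldType) (I : choiceType)
    (B : algType k) (f : I -> B) (x : fa k I) : B :=
  mmap (in_alg B) (fmonom_eval f) x.

Section FreeAlgebraLift.
Variables (k : fieldType) (I : choiceType) (B : algType k) (f : I -> B).

Local Notation fmonom_eval := (fmonom_eval f).
Local Notation fa_lift := (fa_lift f).

Fact fmonom_eval_mmorphism : mmorphism fmonom_eval.
Proof.
by split=> [m m'|]; rewrite /fmonom_eval ?fmM ?big_cat ?fm1 ?big_nil.
Qed.

HB.instance Definition _ :=
  isMultiplicative.Build {fmonom I} B fmonom_eval fmonom_eval_mmorphism.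

Lemma fa_lift_linear : linear fa_lift.
Proof.
by move=> c x y; rewrite /fa_lift mmapD mmapZ /= mulr_algl.
Qed.

HB.instance Definition _ :=
  GRing.isLinear.Build k (fa k I) B *:%R fa_lift fa_lift_linear.

Lemma fa_lift_monoid_morphism : monoid_morphism fa_lift.
Proof.
rewrite /fa_lift; have [|H1 H2] := @commr_mmap_is_multiplicative {fmonom I} k B
  (in_alg B) fmonom_eval.
  by move=> g m m'; rewrite /GRing.comm /= mulr_algl mulr_algr.
by split.
Qed.

HB.instance Definition _ := GRing.isMonoidMorphism.Build (fa k I) B
  fa_lift fa_lift_monoid_morphism.

Lemma fa_liftE i : fa_lift (fa_var k i) = f i.
Proof.
rewrite /fa_lift /fa_var mmapU /= scale1r mul1r.
by rewrite /fmonom_eval fmU big_seq1.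
Qed.

End FreeAlgebraLift.

Fact fa_ext (k : fieldType) (I : choiceType) (B : algType k)
    (f g : {lrmorphism fa k I -> B}) :
  (forall i, f (fa_var k i) = g (fa_var k i)) -> f =1 g.
Proof.
move=> fg; have fgm s : f << 1 *g FMonom s >> = g << 1 *g FMonom s >>.
  elim: s => [|i s IH]; first by rewrite -fmoneE !rmorph1.
  have -> : << 1 *g FMonom (i :: s) >> = fa_var k i * << 1 *g FMonom s >>.
    rewrite /fa_var -[RHS]/(fgmul _ _) fgmulUU mulr1; congr (<< 1 *g _ >>).
    by apply/val_inj; rewrite /= fmM fmU.
  by rewrite !rmorphM /= fg IH.
move=> x; rewrite [x]monalgE !linear_sum; apply: eq_bigr => -[s] _.
by rewrite -[x@_(FMonom s)]mulr1 malgUZ !linearZ /= fgm.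
Qed.

Record freealg_model (k : fieldType) (I : choiceType) := FreealgModel {
  fm_alg : algType k;
  fm_var : I -> fm_alg;
  fm_lift : forall B : algType k, (I -> B) -> {lrmorphism fm_alg -> B};
  fm_liftE : forall (B : algType k) (f : I -> B) i, fm_lift f (fm_var i) = f i;
  fm_ext : forall (B : algType k) (f g : {lrmorphism fm_alg -> B}),
    (forall i, f (fm_var i) = g (fm_var i)) -> f =1 g
}.

HB.lock Definition free_algebra (k : fieldType) (I : choiceType) :
    freealg_model k I :=
  @FreealgModel k I (fa k I) (@fa_var k I) (fun B f => fa_lift f)
    (@fa_liftE k I) (@fa_ext k I).

Definition freealg (k : fieldType) (I : choiceType) : algType k :=
  fm_alg (free_algebra k I).

Definition freevar (k : fieldType) (I : choiceType) : I -> freealg k I :=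
  @fm_var k I (free_algebra k I).

Definition freealg_lift (k : fieldType) (I : choiceType) (B : algType k)
    (f : I -> B) : {lrmorphism freealg k I -> B} :=
  @fm_lift k I (free_algebra k I) B f.

Lemma freealg_liftE (k : fieldType) (I : choiceType) (B : algType k)
  (f : I -> B) i : freealg_lift f (freevar k i) = f i.
Proof. exact: fm_liftE. Qed.

Lemma freealg_ext (k : fieldType) (I : choiceType) (B : algType k)
    (f g : {lrmorphism freealg k I -> B}) :
  (forall i, f (freevar k i) = g (freevar k i)) -> f =1 g.
Proof. exact: fm_ext. Qed.

Section Ideal.
Variables (k : fieldType) (A : algType k) (S : A -> Prop).

(* [lspan ideal_gen] is the two-sided ideal generated by S. *)
Definition ideal_gen (x : A) : Prop := exists a s b, S s /\ x = a * s * b.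

Lemma ideal_mull a x : lspan ideal_gen x -> lspan ideal_gen (a * x).
Proof.
elim=> [|_ [b [s [c [Ss ->]]]]|c u v _ Hu _ Hv].
- by rewrite mulr0; apply: lspan0.
- by apply: lspan_gen; exists (a * b), s, c; rewrite !mulrA.
- by rewrite mulrDr -scalerAr; apply: lspanP.
Qed.

Lemma ideal_mulr a x : lspan ideal_gen x -> lspan ideal_gen (x * a).
Proof.
elim=> [|_ [b [s [c [Ss ->]]]]|c u v _ Hu _ Hv].
- by rewrite mul0r; apply: lspan0.
- by apply: lspan_gen; exists b, s, (c * a); rewrite !mulrA.
- by rewrite mulrDl -scalerAl; apply: lspanP.
Qed.

End Ideal.

Definition aq_mul (k : fieldType) (A : algType k) (S : A -> Prop)
    (x y : lquot (ideal_gen S)) : lquot (ideal_gen S) :=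
  lpi (ideal_gen S) (repr x * repr y).

Section AlgebraQuotient.
Variables (k : fieldType) (A : algType k) (S : A -> Prop).

Local Notation aq_mul := (@aq_mul k A S).
Local Notation ideal_gen := (@ideal_gen k A S).
Local Notation pi := (lpi ideal_gen).

Lemma aq_mulE (u v : A) : aq_mul (pi u) (pi v) = pi (u * v).
Proof.
rewrite /aq_mul; apply/lpi_eqP; set u' := repr _; set v' := repr _.
have -> : u' * v' - u * v = 1 *: (u' * (v' - v)) + (u' - u) * v.
  by rewrite scale1r mulrBr mulrBl addrA addrNK.
apply: lspanP; [apply: ideal_mull|apply: ideal_mulr];
  by apply/lpi_eqP; rewrite lpi_repr.
Qed.

Lemma aq_mulA : associative aq_mul.
Proof.
move=> x y z; have [[u ->] [v ->] [w ->]] := And3 (lpi_surj x) (lpi_surj y) (lpi_surj z).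
by rewrite !aq_mulE mulrA.
Qed.
Lemma aq_mul1l : left_id (pi 1) aq_mul.
Proof. by move=> x; have [u ->] := lpi_surj x; rewrite aq_mulE mul1r. Qed.
Lemma aq_mul1r : right_id (pi 1) aq_mul.
Proof. by move=> x; have [u ->] := lpi_surj x; rewrite aq_mulE mulr1. Qed.
Lemma aq_mulDl : left_distributive aq_mul +%R.
Proof.
move=> x y z; have [[u ->] [v ->] [w ->]] := And3 (lpi_surj x) (lpi_surj y) (lpi_surj z).
by rewrite -lpiD !aq_mulE mulrDl lpiD.
Qed.
Lemma aq_mulDr : right_distributive aq_mul +%R.
Proof.
move=> x y z; have [[u ->] [v ->] [w ->]] := And3 (lpi_surj x) (lpi_surj y) (lpi_surj z).
by rewrite -lpiD !aq_mulE mulrDr lpiD.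
Qed.
Lemma aq_scaleAl (c : k) x y : c *: aq_mul x y = aq_mul (c *: x) y.
Proof.
have [[u ->] [v ->]] := (lpi_surj x, lpi_surj y).
by rewrite aq_mulE -!linearZ aq_mulE scalerAl.
Qed.
Lemma aq_scaleAr (c : k) x y : c *: aq_mul x y = aq_mul x (c *: y).
Proof.
have [[u ->] [v ->]] := (lpi_surj x, lpi_surj y).
by rewrite aq_mulE -!linearZ aq_mulE scalerAr.
Qed.

Lemma ideal_kernel (B : algType k) (f : {lrmorphism A -> B}) x :
  (forall s, S s -> f s = 0) -> lspan ideal_gen x -> f x = 0.
Proof.
move=> fS; elim=> [|_ [a [s [b [Ss ->]]]]|c u v _ Hu _ Hv].
- exact: linear0.
- by rewrite !rmorphM /= (fS s Ss) mulr0 mul0r.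
- by rewrite linearP /= Hu Hv scaler0 addr0.
Qed.

End AlgebraQuotient.

HB.mixin Record isLieAlgebra (k : fieldType) L of Vector k L := {
  lie : L -> L -> L;
  lie_linear_l : forall y : L, linear (lie^~ y);
  lie_linear_r : forall x : L, linear (lie x);
  liexx : forall x : L, lie x x = 0;
  lie_jacobi : forall x y z : L,
    lie x (lie y z) + lie y (lie z x) + lie z (lie x y) = 0
}.

#[short(type="finLieAlgType")]
HB.structure Definition FinLieAlgebra (k : fieldType) :=
  {L of isLieAlgebra k L & Vector k L}.

HB.reexport.

Definition lie_hom (k : fieldType) (L : finLieAlgType k) (B : algType k)
    (f : L -> B) : Prop :=
  linear f /\ forall x y, f (lie x y) = f x * f y - f y * f x.

Section UQ.
Variables (k : fieldType) (L : finLieAlgType k).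

Local Notation X := (@freevar k L).

Inductive uq_rel : freealg k L -> Prop :=
| uq_rel_linear c x y : uq_rel (X (c *: x + y) - (c *: X x + X y))
| uq_rel_lie x y : uq_rel (X x * X y - X y * X x - X (lie x y)).

(* The generators form the underlying set of L, not a basis: uq_rel_linear makes
   the free algebra into the tensor algebra T(L). *)
Definition uq : Type := lquot (ideal_gen uq_rel).

HB.instance Definition _ := GRing.Lmodule.copy uq (lquot (ideal_gen uq_rel)).

Definition uq_pi (u : freealg k L) : uq := lpi (ideal_gen uq_rel) u.

End UQ.

Definition uq_in (k : fieldType) (L : finLieAlgType k) (x : L) :
  uq L := uq_pi (freevar k x).

(* Evaluated on a representative: well defined only when f is a lie_hom. *)
Definition uq_lift (k : fieldType) (L : finLieAlgType k)
    (B : algType k) (f : L -> B) (u : uq L) : B :=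
  freealg_lift f (repr u).

Section UQTheory.
Variables (k : fieldType) (L : finLieAlgType k).

Local Notation X := (@freevar k L).
Local Notation uq := (@uq k L).
Local Notation uq_pi := (@uq_pi k L).
Local Notation uq_in := (@uq_in k L).
Local Notation uq_rel := (@uq_rel k L).

Lemma uq_lift_pi (B : algType k) (f : L -> B) u :
  lie_hom f -> uq_lift f (uq_pi u) = freealg_lift f u.
Proof.
rewrite /uq_lift => -[fl fb]; apply/eqP; rewrite -subr_eq0 -linearB /=; apply/eqP.
apply: (@ideal_kernel _ _ uq_rel _ (freealg_lift f)); last first.
  by apply/lpi_eqP; rewrite lpi_repr.
move=> _ [c x y|x y].
  by rewrite linearB linearP /= !freealg_liftE fl subrr.
by rewrite !linearB /= !rmorphM /= !freealg_liftE fb subrr.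
Qed.

Fact uq_one_neq0 : uq_pi 1 != 0.
Proof.
have h0 : lie_hom (fun _ : L => 0 : k^o).
  by split=> [c x y|x y]; rewrite ?scaler0 ?mulr0 ?subr0 ?addr0.
have pi0 : uq_pi 0 = 0 by exact: (linear0 (lpi (ideal_gen uq_rel))).
rewrite -pi0; apply/eqP => /(congr1 (uq_lift (fun _ => 0 : k^o))).
rewrite !uq_lift_pi //.
by rewrite rmorph1 linear0 => /eqP; rewrite oner_eq0.
Qed.

HB.instance Definition _ := GRing.Zmodule_isNzRing.Build uq
  (@aq_mulA k (freealg k L) uq_rel) (@aq_mul1l _ _ _) (@aq_mul1r _ _ _)
  (@aq_mulDl _ _ _) (@aq_mulDr _ _ _) uq_one_neq0.
HB.instance Definition _ :=
  GRing.Lmodule_isLalgebra.Build k uq (@aq_scaleAl _ _ uq_rel).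
HB.instance Definition _ :=
  GRing.Lalgebra_isAlgebra.Build k uq (@aq_scaleAr _ _ uq_rel).

Lemma uq_pi_surj u : exists v, u = uq_pi v.
Proof. exact: lpi_surj. Qed.

Lemma uq_pi_linear : linear uq_pi.
Proof. exact: lpiP. Qed.

HB.instance Definition _ :=
  GRing.isLinear.Build k (freealg k L) uq *:%R uq_pi uq_pi_linear.

Lemma uq_pi_monoid_morphism : monoid_morphism uq_pi.
Proof. by split=> // u v; rewrite -[RHS]/(aq_mul _ _) aq_mulE. Qed.

HB.instance Definition _ := GRing.isMonoidMorphism.Build (freealg k L) uq
  uq_pi uq_pi_monoid_morphism.

Lemma uq_in_lie_hom : lie_hom uq_in.
Proof.
split=> [c x y|x y].
  rewrite /uq_in -linearP; apply/lpi_eqP; apply: lspan_gen.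
  exists 1, (X (c *: x + y) - (c *: X x + X y)), 1.
  by split; [exact: uq_rel_linear | rewrite mul1r mulr1].
rewrite /uq_in -!rmorphM -linearB; apply/esym/lpi_eqP; apply: lspan_gen.
exists 1, (X x * X y - X y * X x - X (lie x y)), 1.
by split; [exact: uq_rel_lie | rewrite mul1r mulr1].
Qed.

Section UniversalProperty.
Variables (B : algType k) (f : L -> B).
Hypothesis f_lie : lie_hom f.

Lemma uq_lift_linear : linear (uq_lift f).
Proof.
move=> c x y; have [[u ->] [v ->]] := (uq_pi_surj x, uq_pi_surj y).
by rewrite -linearP !uq_lift_pi // linearP.
Qed.

Lemma uq_lift_monoid_morphism : monoid_morphism (uq_lift f).
Proof.
split=> [|x y]; first by rewrite -(rmorph1 uq_pi) uq_lift_pi // rmorph1.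
have [[u ->] [v ->]] := (uq_pi_surj x, uq_pi_surj y).
by rewrite -rmorphM !uq_lift_pi // rmorphM.
Qed.

Lemma uq_lift_in x : uq_lift f (uq_in x) = f x.
Proof. by rewrite /uq_in uq_lift_pi // freealg_liftE. Qed.

End UniversalProperty.

End UQTheory.

Fact uq_ext (k : fieldType) (L : finLieAlgType k) (B : algType k)
    (f g : {lrmorphism uq L -> B}) :
  (forall x, f (uq_in x) = g (uq_in x)) -> f =1 g.
Proof.
move=> fg u; have [v ->] := uq_pi_surj u.
exact: (@freealg_ext _ _ _ (f \o @uq_pi k L) (g \o @uq_pi k L)).
Qed.

Record uea_model (k : fieldType) (L : finLieAlgType k) := UeaModel {
  um_alg : algType k;
  um_in : L -> um_alg;
  um_lift : forall B : algType k, (L -> B) -> um_alg -> B;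
  um_in_lie_hom : lie_hom um_in;
  um_liftP : forall (B : algType k) (f : L -> B), lie_hom f ->
    [/\ linear (um_lift f), monoid_morphism (um_lift f) &
        forall x, um_lift f (um_in x) = f x];
  um_ext : forall (B : algType k) (f g : {lrmorphism um_alg -> B}),
    (forall x, f (um_in x) = g (um_in x)) -> f =1 g
}.

HB.lock Definition universal_enveloping (k : fieldType) (L : finLieAlgType k) :
    uea_model L :=
  @UeaModel k L (uq L) (@uq_in k L) (@uq_lift k L) (@uq_in_lie_hom k L)
    (fun B f h => And3 (uq_lift_linear h) (uq_lift_monoid_morphism h)
                       (uq_lift_in h))
    (@uq_ext k L).

Definition uea (k : fieldType) (L : finLieAlgType k) : algType k :=
  um_alg (universal_enveloping L).

Definition uea_in (k : fieldType) (L : finLieAlgType k) : L -> uea L :=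
  @um_in k L (universal_enveloping L).

Definition uea_lift (k : fieldType) (L : finLieAlgType k) (B : algType k)
    (f : L -> B) : uea L -> B :=
  @um_lift k L (universal_enveloping L) B f.

Section UniversalEnvelopingAlgebra.
Variables (k : fieldType) (L : finLieAlgType k).

Lemma uea_in_lie_hom : lie_hom (@uea_in k L).
Proof. exact: um_in_lie_hom. Qed.

Lemma uea_lift_linear (B : algType k) (f : L -> B) :
  lie_hom f -> linear (uea_lift f).
Proof. by case/(um_liftP (universal_enveloping L)). Qed.

Lemma uea_lift_monoid_morphism (B : algType k) (f : L -> B) :
  lie_hom f -> monoid_morphism (uea_lift f).
Proof. by case/(um_liftP (universal_enveloping L)). Qed.

Lemma uea_lift_in (B : algType k) (f : L -> B) :
  lie_hom f -> forall x, uea_lift f (uea_in x) = f x.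
Proof. by case/(um_liftP (universal_enveloping L)). Qed.

Lemma uea_ext (B : algType k) (f g : {lrmorphism uea L -> B}) :
  (forall x, f (uea_in x) = g (uea_in x)) -> f =1 g.
Proof. exact: um_ext. Qed.

End UniversalEnvelopingAlgebra.

Definition coproduct (k : fieldType) (L : finLieAlgType k) :
    uea L -> uea L ⊗[k] uea L :=
  uea_lift (fun x => uea_in x ⊗ 1 + 1 ⊗ uea_in x).

Section Coproduct.
Variables (k : fieldType) (L : finLieAlgType k).

Local Notation uea := (uea L).
Local Notation uea_in := (@uea_in k L).
Local Notation coproduct := (@coproduct k L).

Let primitive (x : L) : uea ⊗[k] uea := uea_in x ⊗ 1 + 1 ⊗ uea_in x.

Lemma primitive_lie_hom : lie_hom primitive.
Proof.
have [il ib] := @uea_in_lie_hom k L; split=> [c x y|x y].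
  by rewrite /primitive il tensPl tensPr scalerDr addrACA.
rewrite /primitive ib !(mulrDl, mulrDr) !tensM !mulr1 !mul1r.
have Bl (a b : uea) : (a - b) ⊗ 1 = a ⊗ 1 - b ⊗ 1 :> uea ⊗[k] uea.
  by rewrite addrC -scaleN1r tensPl scaleN1r addrC.
have Br (a b : uea) : 1 ⊗ (a - b) = 1 ⊗ a - 1 ⊗ b :> uea ⊗[k] uea.
  by rewrite addrC -scaleN1r tensPr scaleN1r addrC.
have E (V : zmodType) (p q r s m n : V) :
    p + m + (n + r) - (q + n + (m + s)) = p - q + (r - s).
  rewrite [n + r]addrC addrACA [m + s]addrC [q + n + _]addrACA [n + m]addrC.
  by rewrite [q + s + _]addrC addrKA opprD addrACA.
by rewrite Bl Br E.
Qed.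

Lemma coproduct_linear : linear coproduct.
Proof. exact: (uea_lift_linear primitive_lie_hom). Qed.

Lemma coproduct_monoid_morphism : monoid_morphism coproduct.
Proof. exact: (uea_lift_monoid_morphism primitive_lie_hom). Qed.

HB.instance Definition _ := GRing.isLinear.Build k uea (uea ⊗[k] uea) *:%R
  coproduct coproduct_linear.
HB.instance Definition _ := GRing.isMonoidMorphism.Build uea (uea ⊗[k] uea)
  coproduct coproduct_monoid_morphism.

Lemma coproductE x : coproduct (uea_in x) = uea_in x ⊗ 1 + 1 ⊗ uea_in x.
Proof. exact: (uea_lift_in primitive_lie_hom). Qed.

End Coproduct.

(* Main.v *)
From HB Require Import structures.
Require Import Defs.
From mathcomp Require Import all_boot all_algebra.
From mathcomp Require Import ring.
From mathcomp Require Import boolp.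

Import GRing.Theory.
Local Open Scope ring_scope.

Set Implicit Arguments.
Unset Strict Implicit.
Unset Printing Implicit Defensive.

(** Write H for U(delta), and filter H and its tensor powers by the length of
words in the generators.  The leading part of a noncommutative expression is a
commutative polynomial, its symbol, and the proof reads off from the equation
an identity between symbols.

If alpha has degree d >= 1 and symbol F(x, y), where x and y are vectors of
commuting coordinates, homogeneous of total degree d, then the equation forces
<<
  (F(x,y) - F(y,x)) F(x+y,z) = F(y,z) F(x,y+z) - F(x,z) F(y,x+z),
>>
because Delta becomes addition of the arguments.  Replace y by t y, expand in
powers of t and let F_r be the component of F of degree r in its second
argument.  If the coefficients below t^r vanish, then the coefficient of t^r is
F(x,z) times
<<
  F_r(x,y) - F_{d-r}(y,x) - F_{d-r}(y,z) + F_{d-r}(y,x+z),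
>>
and F <> 0 can be cancelled, since polynomial functions over an infinite field
have no zero divisors.  Putting z = 0 gives F_r = 0.  What is left says that
F_{d-r} is additive in its second argument, in which it is homogeneous of
degree d-r; in characteristic 0 it is zero unless d-r = 1.  So F_r = 0 for all
r < d, and also F_d = 0 when d >= 2.  Hence d <= 1 and F(x, 0) = 0, which means
that alpha = 1 (x) s + t (lemmas low_order_relation, components_eq0,
symbol_degree_le1, symbol_r0).

Two facts make symbols usable.  An element of degree at most d with zero symbol
has degree less than d: modulo shorter words a product of generators can be
sorted, and sorted words have linearly independent symbols (has_symbol_eq0).
Conversely the zero element has no nonzero symbol.  This comes from the
coproduct: a functional xi on H with xi(1) = 0 acts on H by
u |-> (xi (x) id) Delta(u), which behaves like the derivation g |-> xi(g) up to
lower order, so iterating it d times on a word of length d multiplies the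
values xi(g) together, times d! (uea_separated).  This yields functionals that
compute the values of the symbol, and such functionals multiply under tensor
products (tensor_gen_separated).  As generators one takes a basis of the image
of delta in H, so that the values xi(g) can be prescribed.

Conversely, for alpha = 1 (x) s + t the two sides of the equation agree because
the expression to be symmetrized has the form 1 (x) 1 (x) u (defect_solution). *)

(** * Linear functions *)

Section LinearFunctions.
Variable k : fieldType.

Lemma linear_fun0 (V W : lmodType k) (f : V -> W) : linear f -> f 0 = 0.
Proof. by move=> fl; have := fl (-1) 0 0; rewrite scaler0 addr0 scaleN1r addNr. Qed.

Lemma linear_funD (V W : lmodType k) (f : V -> W) :
  linear f -> {morph f : x y / x + y}.
Proof. by move=> fl x y; rewrite -{1}[x]scale1r fl scale1r. Qed.

Lemma linear_funZ (V W : lmodType k) (f : V -> W) a :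
  linear f -> {morph f : x / a *: x}.
Proof. by move=> fl x; rewrite -[a *: x]addr0 fl linear_fun0 // addr0. Qed.

Lemma linear_funB (V W : lmodType k) (f : V -> W) :
  linear f -> {morph f : x y / x - y}.
Proof. by move=> fl x y; rewrite addrC -scaleN1r fl scaleN1r addrC. Qed.

Lemma linear_fun_sum (V W : lmodType k) (f : V -> W) (J : Type) (r : seq J)
    (F : J -> V) : linear f -> f (\sum_(j <- r) F j) = \sum_(j <- r) f (F j).
Proof.
by move=> fl; apply: (big_morph f (linear_funD fl)); exact: linear_fun0.
Qed.

End LinearFunctions.

(** * Polynomial functions and the equation for symbols *)

Section PolynomialFunctions.
Variable k : closedFieldType.

(** Being polynomial on every line is all that cancellation requires, and this
form avoids choosing coordinates. *)
Definition polyfun (V : lmodType k) (f : V -> k) : Prop :=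
  forall u v : V, exists q : {poly k}, forall t, f (u + t *: v) = q.[t].

Lemma horner_eq0 (q : {poly k}) : (forall t, q.[t] = 0) -> q = 0.
Proof.
move=> q0; apply/eqP/negPn/negP => /closed_nonrootP[t].
by rewrite /root q0 eqxx.
Qed.

Lemma horner_inj (q r : {poly k}) : (forall t, q.[t] = r.[t]) -> q = r.
Proof.
move=> qr; apply/eqP; rewrite -subr_eq0; apply/eqP/horner_eq0 => t.
by rewrite hornerD hornerN qr subrr.
Qed.

Lemma polyfun_eq (V : lmodType k) (f g : V -> k) :
  polyfun f -> f =1 g -> polyfun g.
Proof. by move=> pf fg u v; have [q qE] := pf u v; exists q => t; rewrite -fg. Qed.

Lemma polyfun_const (V : lmodType k) (c : k) : polyfun (fun _ : V => c).
Proof. by move=> u v; exists c%:P => t; rewrite hornerC. Qed.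

Lemma polyfunD (V : lmodType k) (f g : V -> k) :
  polyfun f -> polyfun g -> polyfun (fun v => f v + g v).
Proof.
move=> pf pg u v; have [[q qE] [r rE]] := (pf u v, pg u v).
by exists (q + r) => t; rewrite hornerD qE rE.
Qed.

Lemma polyfunM (V : lmodType k) (f g : V -> k) :
  polyfun f -> polyfun g -> polyfun (fun v => f v * g v).
Proof.
move=> pf pg u v; have [[q qE] [r rE]] := (pf u v, pg u v).
by exists (q * r) => t; rewrite hornerM qE rE.
Qed.

Lemma polyfunN (V : lmodType k) (f : V -> k) :
  polyfun f -> polyfun (fun v => - f v).
Proof. by move=> pf u v; have [q qE] := pf u v; exists (- q) => t; rewrite hornerN qE. Qed.

Lemma polyfun_sum (V : lmodType k) (I : Type) (r : seq I) (f : I -> V -> k) :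
  (forall i, polyfun (f i)) -> polyfun (fun v => \sum_(i <- r) f i v).
Proof.
move=> pf; elim: r => [|i r IH].
  by apply: (polyfun_eq (@polyfun_const V 0)) => v; rewrite big_nil.
by apply: (polyfun_eq (polyfunD (pf i) IH)) => v; rewrite big_cons.
Qed.

Lemma polyfun_comp (U V : lmodType k) (h : U -> V) (f : V -> k) :
  linear h -> polyfun f -> polyfun (fun u => f (h u)).
Proof.
move=> hl pf u v; have [q qE] := pf (h u) (h v).
by exists q => t; rewrite addrC hl addrC qE.
Qed.

(** Restricted to the line from a point where f does not vanish to an arbitrary
point, the identity f * g = 0 takes place in the domain of univariate
polynomials. *)
Lemma polyfun_mul_eq0 (V : lmodType k) (f g : V -> k) :
  polyfun f -> polyfun g -> (forall v, f v * g v = 0) ->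
  (exists v, f v != 0) -> forall v, g v = 0.
Proof.
move=> pf pg fg0 [u fu0] v.
have [q qE] := pf u (v - u); have [r rE] := pg u (v - u).
have /eqP : q * r = 0 by apply: horner_eq0 => t; rewrite hornerM -qE -rE.
rewrite mulf_eq0 => /orP[]/eqP e0.
  by move: fu0; have := qE 0; rewrite scale0r addr0 e0 horner0 => ->; rewrite eqxx.
by have := rE 1; rewrite scale1r addrC subrK e0 horner0.
Qed.

(** At the lowest order that may occur in p, only the constant term of q counts. *)
Lemma coefM_low (p q : {poly k}) r :
  (forall i, (i < r)%N -> p`_i = 0) -> (p * q)`_r = p`_r * q`_0.
Proof.
move=> p0; rewrite coefM big_ord_recr /= subnn big1 ?add0r // => i _.
by rewrite p0 // mul0r.
Qed.

(** This is how additivity and homogeneity of degree e > 1 are incompatible: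
both compute the value at a doubled argument. *)
Lemma double_power_eq0 (c : k) e : [pchar k] =i pred0 -> (1 < e)%N ->
  2%:R ^+ e * c = 2%:R * c -> c = 0.
Proof.
move=> /pcharf0P char0 e1 /eqP; rewrite -subr_eq0 -mulrBl mulf_eq0 => /orP[|/eqP//].
rewrite -natrX -natrB; last by rewrite -{1}(expn1 2) leq_exp2l // ltnW.
by rewrite char0 subn_eq0 -{2}(expn1 2) leq_exp2l // leqNgt e1.
Qed.

Section SymbolEquation.
Variables (V : lmodType k) (d : nat) (F : V -> V -> k) (Fj : nat -> V -> V -> k).
Hypothesis char0 : [pchar k] =i pred0.
Hypothesis F_sum : forall x y, F x y = \sum_(j < d.+1) Fj j x y.
Hypothesis Fj_homog : forall j a b x y, (j <= d)%N ->
  Fj j (a *: x) (b *: y) = a ^+ (d - j) * b ^+ j * Fj j x y.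
Hypothesis Fj_poly : forall j, polyfun (fun v : V * V => Fj j v.1 v.2).
Hypothesis F_eqn : forall x y z,
  (F x y - F y x) * F (x + y) z = F y z * F x (y + z) - F x z * F y (x + z).
Hypothesis F_neq0 : exists x y, F x y != 0.

Lemma F_poly : polyfun (fun v : V * V => F v.1 v.2).
Proof.
apply: (polyfun_eq (polyfun_sum (index_enum _) (fun j : 'I_d.+1 => Fj_poly j))).
by move=> v /=; rewrite F_sum.
Qed.

Lemma F_scale_r x y t : F x (t *: y) = (\poly_(j < d.+1) Fj j x y).[t].
Proof.
rewrite horner_poly F_sum; apply: eq_bigr => j _.
by rewrite -{1}[x]scale1r Fj_homog ?leq_ord // expr1n mul1r mulrC.
Qed.

Lemma F_scale_l x y t : F (t *: y) x = (\poly_(j < d.+1) Fj (d - j) y x).[t].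
Proof.
rewrite horner_poly F_sum (reindex_inj rev_ord_inj) /=; apply: eq_bigr => j _.
rewrite subSS -{1}[x]scale1r Fj_homog ?leq_subr // subKn ?leq_ord //.
by rewrite expr1n mulr1 mulrC.
Qed.

(** Coefficient of t^r in the equation at (x, t y, z): the factors F(x, t y),
F(t y, x), F(t y, z) and F(t y, x + z) all start at order r, so that the
remaining factors contribute only their value F(x, z) at t = 0. *)
Lemma low_order_relation r : (r <= d)%N ->
  (forall j, (j < r)%N -> forall x y, Fj j x y = 0) ->
  (forall j, (j < r)%N -> forall x y, Fj (d - j) x y = 0) ->
  forall x y z,
    Fj r x y - Fj (d - r) y x - Fj (d - r) y z + Fj (d - r) y (x + z) = 0.
Proof.
move=> rd A0 B0 x y z.
(* f is the common factor to be cancelled from f * g = 0 *)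
pose f (v : V * V * V) := F v.1.1 v.2.
pose g (v : V * V * V) := Fj r v.1.1 v.1.2 - Fj (d - r) v.1.2 v.1.1
  - Fj (d - r) v.1.2 v.2 + Fj (d - r) v.1.2 (v.1.1 + v.2).
suff: forall v, g v = 0 by move/(_ ((x, y), z)).
have comp2 (G : V -> V -> k) (h1 h2 : V * V * V -> V) :
    polyfun (fun v : V * V => G v.1 v.2) -> linear h1 -> linear h2 ->
    polyfun (fun v => G (h1 v) (h2 v)).
  move=> pG l1 l2; apply: (@polyfun_comp _ _ (fun v => (h1 v, h2 v)) _ _ pG).
  by move=> c u v; rewrite l1 l2.
apply: (@polyfun_mul_eq0 _ f g).
- by apply: (comp2 F) => //; exact: F_poly.
- rewrite /g; do ?[apply: polyfunD|apply: polyfunN]; apply: comp2 => //.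
  by move=> c u v /=; rewrite scalerDr addrACA.
- move=> {x y z} [[x y] z]; rewrite /f /g /=.
  have [q1 q1E] := F_poly (x, z) (y, 0).
  have [q2 q2E] := F_poly (x, z) (0, y).
  have q1t t : F (x + t *: y) z = q1.[t].
    by rewrite -q1E /= scaler0 addr0.
  have q2t t : F x (t *: y + z) = q2.[t].
    by rewrite -q2E /= scaler0 addr0 addrC.
  pose A u := \poly_(j < d.+1) Fj j u y.
  pose B u := \poly_(j < d.+1) Fj (d - j) y u.
  have AB_low u j : (j < r)%N -> ((A u)`_j = 0) * ((B u)`_j = 0).
    by move=> jr; rewrite !coef_poly A0 // B0 // !if_same.
  have : (A x - B x) * q1 = B z * q2 - B (x + z) * (F x z)%:P.
    apply: horner_inj => t.
    rewrite !(hornerM, hornerD, hornerN, hornerC) -!F_scale_r -!F_scale_l.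
    by rewrite -q1t -q2t F_eqn [F x z * _]mulrC.
  move/(congr1 (fun p : {poly k} => p`_r)); rewrite coefB !coefM_low; last 3 first.
  - by move=> i ir; rewrite AB_low.
  - by move=> i ir; rewrite AB_low.
  - by move=> i ir; rewrite coefB !AB_low // subrr.
  rewrite coefB !coef_poly ltnS rd coefC eqxx -!horner_coef0 -q1t -q2t.
  rewrite scale0r addr0 add0r => e.
  set f0 := F x z in e *; set a := Fj r x y in e *.
  set b := Fj (d - r) y x in e *; set b' := Fj (d - r) y (x + z) in e *.
  set c := Fj (d - r) y z in e *.
  have -> : f0 * (a - b - c + b') = (a - b) * f0 - (c * f0 - b' * f0) by ring.
  by rewrite e subrr.
- by have [x' [y' F0]] := F_neq0; exists ((x', 0), y').
Qed.

(** In the relation of order r, z = 0 isolates the first term; the rest says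
that the component F_(d-r) is additive in its second argument. *)
Lemma components_eq0 r : (r < d)%N ->
  (forall x y, Fj r x y = 0) /\
  ((1 < d - r)%N -> forall x y, Fj (d - r) x y = 0).
Proof.
elim/ltn_ind: r => r IH rd.
have A0 j : (j < r)%N -> forall x y, Fj j x y = 0.
  by move=> jr; exact: (IH j jr (ltn_trans jr rd)).1.
have B0 j : (j < r)%N -> forall x y, Fj (d - j) x y = 0.
  move=> jr; apply: (IH j jr (ltn_trans jr rd)).2.
  by rewrite ltn_subRL addn1 (leq_ltn_trans jr rd).
have rel := low_order_relation (ltnW rd) A0 B0.
have Fy0 y : Fj (d - r) y 0 = 0.
  rewrite -(scale0r 0) -{1}[y]scale1r Fj_homog ?leq_subr // expr0n.
  by rewrite subn_eq0 leqNgt rd mulr0 mul0r.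
have Fr0 x y : Fj r x y = 0.
  by have := rel x y 0; rewrite Fy0 addr0 subr0 subrK.
split=> // dr x y; apply: (double_power_eq0 char0 dr).
have <- : Fj (d - r) x (2%:R *: y) = 2%:R * Fj (d - r) x y.
  apply/eqP; rewrite -subr_eq0 -(rel y x y) Fr0 scaler_nat mulr2n.
  by apply/eqP; ring.
by rewrite -{2}[x]scale1r Fj_homog ?leq_subr // expr1n mul1r.
Qed.

Lemma symbol_degree_le1 : (d <= 1)%N.
Proof.
rewrite leqNgt; apply/negP => d1; have [x [y /eqP[]]] := F_neq0.
rewrite F_sum big1 // => j _; have [jd|dj] := ltnP j d.
  exact: (components_eq0 jd).1.
have -> : j = (d - 0)%N :> nat by apply/eqP; rewrite subn0 eqn_leq dj leq_ord.
by apply: (components_eq0 (ltnW d1)).2; rewrite subn0.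
Qed.

(** F(x, 0) is the component of order 0 in the second argument. *)
Lemma symbol_r0 x : (0 < d)%N -> F x 0 = 0.
Proof.
move=> d0; rewrite F_sum big1 // => j _; have [jd|dj] := ltnP j d.
  exact: (components_eq0 jd).1.
rewrite -(scale0r 0) -[x]scale1r Fj_homog ?leq_ord //.
by rewrite expr0n (gtn_eqF (leq_trans d0 dj)) mulr0 mul0r.
Qed.

End SymbolEquation.
End PolynomialFunctions.

(** * Words, filtration and symbols *)

Section LinearSpan.
Variables (k : fieldType) (V : lmodType k) (S : V -> Prop).

Lemma lspanD u v : lspan S u -> lspan S v -> lspan S (u + v).
Proof. by move=> Su; rewrite -[u]scale1r; exact: lspanP. Qed.

Lemma lspanZ a u : lspan S u -> lspan S (a *: u).
Proof. by move=> Su; rewrite -[a *: u]addr0; apply: lspanP => //; exact: lspan0. Qed.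

Lemma lspan_sum (J : Type) (r : seq J) (P : pred J) (f : J -> V) :
  (forall j, P j -> lspan S (f j)) -> lspan S (\sum_(j <- r | P j) f j).
Proof. by move=> Sf; elim/big_ind: _ => //; [exact: lspan0 | exact: lspanD]. Qed.

Lemma lspan_map (W : lmodType k) (T : W -> Prop) (f : V -> W) u :
  linear f -> (forall v, S v -> lspan T (f v)) -> lspan S u -> lspan T (f u).
Proof.
move=> fl fS; elim=> [|v /fS//|a v w _ IHv _ IHw]; last by rewrite fl; exact: lspanP.
suff -> : f 0 = 0 by exact: lspan0.
exact: linear_fun0.
Qed.

End LinearSpan.

Lemma mulr_linear_l (k : fieldType) (A : algType k) (a : A) : linear ( *%R a).
Proof. by move=> c x y; rewrite mulrDr -scalerAr. Qed.

Lemma mulr_linear_r (k : fieldType) (A : algType k) (a : A) : linear (fun x => x * a).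
Proof. by move=> c x y; rewrite mulrDl -scalerAl. Qed.

Definition point (k : fieldType) (I : finType) := {ffun I -> k^o}.

Section Words.
Variables (k : fieldType) (I : finType) (A : algType k) (g : I -> A).

Definition word (w : seq I) : A := \prod_(i <- w) g i.

(** Strict bound on the length: filt 0 is the zero space, so statements about
elements of lower order need no special case in degree 0. *)
Definition filt (n : nat) : A -> Prop :=
  lspan (fun u => exists2 w, (size w < n)%N & u = word w).

Definition monom (w : seq I) (v : point k I) : k := \prod_(i <- w) (v i : k).

Lemma word_cat s t : word (s ++ t) = word s * word t.
Proof. exact: big_cat. Qed.

Lemma word_cons i s : word (i :: s) = g i * word s.
Proof. exact: big_cons. Qed.

Lemma filt_word w n : (size w < n)%N -> filt n (word w).
Proof. by move=> wn; apply: lspan_gen; exists w. Qed.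

Lemma filt1 : filt 1 1.
Proof. by have := @filt_word [::] 1 erefl; rewrite /word big_nil. Qed.

Lemma filtW m n u : (m <= n)%N -> filt m u -> filt n u.
Proof.
move=> mn; apply: (@lspan_map _ _ _ _ _ id) => // _ [w wm ->].
exact/filt_word/(leq_trans wm).
Qed.

Lemma filt0 u : filt 0 u -> u = 0.
Proof. by elim=> [//|v [] //|a v w _ -> _ ->]; rewrite scaler0 addr0. Qed.

Lemma filt_wordMl w n u : filt n u -> filt (size w + n) (word w * u).
Proof.
apply: lspan_map => [|_ [w' wn ->]]; first exact: mulr_linear_l.
by rewrite -word_cat; apply: filt_word; rewrite size_cat ltn_add2l.
Qed.

Lemma filt_wordMr w n u : filt n u -> filt (n + size w) (u * word w).
Proof.
apply: (@lspan_map _ _ _ _ _ (fun x => x * word w)) => [|_ [w' wn ->]].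
  exact: mulr_linear_r.
by rewrite -word_cat; apply: filt_word; rewrite size_cat ltn_add2r.
Qed.

Lemma filt_genMl i n u : filt n u -> filt n.+1 (g i * u).
Proof. by move/(filt_wordMl [:: i]); rewrite /word big_seq1. Qed.

(** u has an expression as a combination of words of length at most d whose
part of length exactly d becomes p when the letters are read as commuting
coordinates.  A relation, since a priori u may have several such p. *)
Inductive has_symbol (d : nat) : A -> (point k I -> k) -> Prop :=
| has_symbol_zero p : (forall v, p v = 0) -> has_symbol d 0 p
| has_symbol_cons c w u p q : (size w <= d)%N -> has_symbol d u p ->
    (forall v, q v = (if size w == d then c * monom w v else 0) + p v) ->
    has_symbol d (c *: word w + u) q.

Lemma has_symbol_ext d u p q : p =1 q -> has_symbol d u p -> has_symbol d u q.
Proof.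
move=> pq h; case: h pq => [p' p0|c w u' p' p'' wd h p''E] pq.
  by apply: has_symbol_zero => v; rewrite -pq.
by apply: (has_symbol_cons wd h) => v; rewrite -pq.
Qed.

Lemma has_symbolP d a u p u' p' : has_symbol d u p -> has_symbol d u' p' ->
  has_symbol d (a *: u + u') (fun v => a * p v + p' v).
Proof.
move=> h h'; elim: h => [q q0|c w v q q' wd _ IH q'E].
  by rewrite scaler0 add0r; apply: has_symbol_ext h' => v; rewrite q0 mulr0 add0r.
rewrite scalerDr scalerA -addrA; apply: (has_symbol_cons wd IH) => x.
by rewrite q'E mulrDr addrA; congr (_ + _ + _); case: ifP; rewrite ?mulr0 ?mulrA.
Qed.

Lemma has_symbol_word w : has_symbol (size w) (word w) (monom w).
Proof.
rewrite -[word w]scale1r -[_ *: _]addr0.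
apply: (@has_symbol_cons _ _ _ _ (fun=> 0)) => [//||v]; first exact: has_symbol_zero.
by rewrite eqxx mul1r addr0.
Qed.

Lemma filt_has_symbol d u : filt d u -> has_symbol d u (fun=> 0).
Proof.
elim=> [|_ [w wd ->]|a v w _ IHv _ IHw]; first exact: has_symbol_zero.
  rewrite -[word w]scale1r -[_ *: _]addr0.
  apply: (@has_symbol_cons _ _ _ _ (fun=> 0)) => [||v]; first exact: ltnW.
    exact: has_symbol_zero.
  by rewrite (ltn_eqF wd) addr0.
by apply: has_symbol_ext (has_symbolP a IHv IHw) => x; rewrite mulr0 addr0.
Qed.

Lemma has_symbol_filt d u p : has_symbol d u p -> filt d.+1 u.
Proof.
elim=> [q _|c w v q q' wd _ IH _]; first exact: lspan0.
by apply: lspanP => //; apply: filt_word.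
Qed.

Lemma has_symbol_wordM w d u p : has_symbol d u p ->
  has_symbol (size w + d) (word w * u) (fun v => monom w v * p v).
Proof.
elim=> [q q0|c w' v q q' wd _ IH q'E].
  by rewrite mulr0; apply: has_symbol_zero => x; rewrite q0 mulr0.
rewrite mulrDr -scalerAr -word_cat.
have sz : (size (w ++ w') <= size w + d)%N by rewrite size_cat leq_add2l.
apply: (has_symbol_cons sz IH) => x.
rewrite q'E mulrDr size_cat eqn_add2l; congr (_ + _); case: ifP; rewrite ?mulr0 //.
by rewrite /monom big_cat mulrCA.
Qed.

Lemma has_symbolM d e u p u' p' : has_symbol d u p -> has_symbol e u' p' ->
  has_symbol (d + e) (u * u') (fun v => p v * p' v).
Proof.
move=> h h'; elim: h => [q q0|c w v q q' wd _ IH q'E].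
  by rewrite mul0r; apply: has_symbol_zero => x; rewrite q0 mul0r.
rewrite mulrDl -scalerAl.
pose r x := if size w == d then monom w x * p' x else 0.
suff hw : has_symbol (d + e) (word w * u') r.
  apply: has_symbol_ext (has_symbolP c hw IH) => x.
  by rewrite q'E mulrDl /r; case: ifP; rewrite ?mul0r ?mulr0 ?mulrA.
rewrite /r; case: eqP => [<-|/eqP wNd]; first exact: has_symbol_wordM.
apply: filt_has_symbol; apply: (@filtW (size w + e.+1)).
  by rewrite addnS -addSn leq_add2r ltn_neqAle wNd.
by apply: filt_wordMl; apply: has_symbol_filt h'.
Qed.

End Words.

(** Symbols transform under algebra morphisms by substitution as soon as the
generators do: phi is the induced map on points. *)
Lemma has_symbol_map (k : fieldType) (I J : finType) (A B : algType k)
    (g : I -> A) (h : J -> B) (f : A -> B) (phi : point k J -> point k I) d u p :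
  linear f -> f 1 = 1 -> {morph f : x y / x * y} ->
  (forall i, has_symbol h 1 (f (g i)) (fun v => phi v i)) ->
  has_symbol g d u p -> has_symbol h d (f u) (fun v => p (phi v)).
Proof.
move=> fl f1 fM fg.
have fw w : has_symbol h (size w) (f (word g w)) (fun v => monom w (phi v)).
  elim: w => [|i w IH].
    rewrite /word big_nil f1; have := has_symbol_word h [::].
    by rewrite /word big_nil; apply: has_symbol_ext => v; rewrite /monom !big_nil.
  rewrite word_cons fM -[size _]add1n; apply: has_symbol_ext (has_symbolM (fg i) IH).
  by move=> v; rewrite /monom big_cons.
elim=> [q q0|c w v q q' wd _ IH q'E].
  have -> : f 0 = 0 by exact: linear_fun0.
  by apply: has_symbol_zero => x; rewrite q0.
rewrite fl; pose r x := if size w == d then monom w (phi x) else 0.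
suff hw : has_symbol h d (f (word g w)) r.
  apply: has_symbol_ext (has_symbolP c hw IH) => x.
  by rewrite q'E /r; case: ifP; rewrite ?mulr0.
rewrite /r; case: eqP => [<-//|/eqP wNd]; apply: filt_has_symbol.
by apply: filtW (has_symbol_filt (fw w)); rewrite ltn_neqAle wNd.
Qed.

(** * Elements with zero symbol have lower order *)

Section NormalForm.
Variables (k : closedFieldType) (I : finType) (A : algType k) (g : I -> A).
Hypothesis comm : forall i j, filt g 2 (g i * g j - g j * g i).

Lemma gen_word_comm i w : filt g (size w).+1 (g i * word g w - word g w * g i).
Proof.
elim: w => [|j w IH].
  by rewrite /word big_nil mulr1 mul1r subrr; exact: lspan0.
have -> : g i * word g (j :: w) - word g (j :: w) * g i =
    (g i * g j - g j * g i) * word g w + g j * (g i * word g w - word g w * g i).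
  by rewrite word_cons !mulrBr !mulrBl !mulrA addrA subrK.
by apply: lspanD; [exact: (filt_wordMr w (comm i j)) | exact: filt_genMl].
Qed.

Lemma word_perm w w' : perm_eq w w' -> filt g (size w) (word g w - word g w').
Proof.
elim: w w' => [|i w IH] w' pw.
  by rewrite perm_sym in pw; rewrite (perm_nilP pw) subrr; exact: lspan0.
have iw' : i \in w' by rewrite -(perm_mem pw) mem_head.
case/splitPr: iw' pw => t1 t2 pw.
have {}pw : perm_eq w (t1 ++ t2).
  by move: pw; rewrite perm_sym -[i :: t2]cat1s perm_catCA perm_cons perm_sym.
have sz := perm_size pw; rewrite size_cat in sz.
have -> : word g (i :: w) - word g (t1 ++ i :: t2) =
    g i * (word g w - word g (t1 ++ t2)) +
    (g i * word g t1 - word g t1 * g i) * word g t2.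
  by rewrite !(word_cons, word_cat) !mulrBr !mulrBl !mulrA addrA subrK.
apply: lspanD; first exact: filt_genMl (IH _ pw).
by rewrite /= sz -addSn; apply: filt_wordMr; exact: gen_word_comm.
Qed.

(** u is a combination of sorted words of length d, with letters in the order of
s, and p is the same combination of sorted monomials.  The recursion groups the
words by the number e of occurrences of the first letter. *)
Fixpoint normal_form (s : seq I) (d : nat) (u : A) (p : point k I -> k) : Prop :=
  if s is i :: s' then
    exists (U : nat -> A) (P : nat -> point k I -> k),
      [/\ forall e, (e <= d)%N -> normal_form s' (d - e) (U e) (P e),
          u = \sum_(e < d.+1) g i ^+ e * U e &
          forall v, p v = \sum_(e < d.+1) (v i : k) ^+ e * P e v]
  else exists c, u = (if d == 0%N then c else 0)%:A /\
                 forall v, p v = if d == 0%N then c else 0.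

Lemma normal_form_zero s d : normal_form s d 0 (fun=> 0).
Proof.
elim: s d => [|i s IH] d /=; first by exists 0; split=> [|v]; case: ifP; rewrite ?scale0r.
exists (fun=> 0), (fun _ _ => 0); split=> // [|v]; first by rewrite big1 // => e; rewrite mulr0.
by rewrite big1 // => e; rewrite mulr0.
Qed.

Lemma normal_formP s d a u p u' p' : normal_form s d u p -> normal_form s d u' p' ->
  normal_form s d (a *: u + u') (fun v => a * p v + p' v).
Proof.
elim: s d u p u' p' => [|i s IH] d u p u' p' /=.
  move=> [c [-> pE]] [c' [-> pE']]; exists (a * c + c'); split=> [|v].
    by case: ifP; rewrite ?scale0r ?scaler0 ?addr0 // scalerDl scalerA.
  by rewrite pE pE'; case: ifP; rewrite ?mulr0 ?addr0.
move=> [U [P [hU -> pE]]] [U' [P' [hU' -> pE']]].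
exists (fun e => a *: U e + U' e), (fun e v => a * P e v + P' e v); split=> [e ed||v].
- by apply: IH; [exact: hU | exact: hU'].
- rewrite scaler_sumr -big_split; apply: eq_bigr => e _.
  by rewrite mulrDr -scalerAr.
- rewrite pE pE' mulr_sumr -big_split; apply: eq_bigr => e _ /=; ring.
Qed.

Lemma normal_form_dep s d u p (v v' : point k I) : normal_form s d u p ->
  {in s, v =1 v'} -> p v = p v'.
Proof.
elim: s d u p => [|i s IH] d u p /=; first by case=> c [_ pE] _; rewrite !pE.
case=> U [P [hU _ pE]] vv'; rewrite !pE; apply: eq_bigr => e _.
rewrite vv' ?mem_head //; congr (_ * _); apply: (IH _ _ _ (hU e _)) => [|j js].
  exact: leq_ord.
by apply: vv'; rewrite inE js orbT.
Qed.

(** Monomials are linearly independent functions: as a polynomial in the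
coordinate of the first letter alone, p has coefficients P e that depend only
on the other coordinates, and these must all vanish. *)
Lemma normal_form_eq0 s d u p : uniq s -> normal_form s d u p ->
  (forall v, p v = 0) -> u = 0.
Proof.
elim: s d u p => [|i s IH] d u p /=.
  move=> _ [c [-> pE]] p0; have := p0 [ffun=> 0]; rewrite pE => ->; exact: scale0r.
case/andP=> iNs us [U [P [hU -> pE]]] p0; rewrite big1 // => e _.
have ed := leq_ord e; rewrite (IH _ _ _ us (hU e ed)) ?mulr0 // => v.
(* p along the line where only the coordinate i of v varies *)
pose q : {poly k} := \poly_(j < d.+1) P j v.
have q0 : q = 0.
  apply: horner_eq0 => t; rewrite -(p0 [ffun j => if j == i then t else v j]).
  rewrite pE horner_poly; apply: eq_bigr => j _; rewrite ffunE eqxx mulrC.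
  congr (_ * _); apply: (normal_form_dep (hU j (leq_ord j))) => l ls.
  by rewrite ffunE; case: eqP => // li; rewrite -li ls in iNs.
by have := congr1 (fun r : {poly k} => r`_e) q0; rewrite coef_poly ltn_ord coef0.
Qed.

Lemma word_normal_form s w : {subset w <= s} ->
  exists2 u, normal_form s (size w) u (monom w) & filt g (size w) (word g w - u).
Proof.
elim: s w => [|i s IH] w ws.
  case: w ws => [_|i w /(_ i (mem_head _ _)) //]; exists 1; last first.
    by rewrite /word big_nil subrr; exact: lspan0.
  by exists 1; rewrite scale1r; split=> // v; rewrite /monom big_nil.
pose e := count_mem i w; pose w' := [seq j <- w | j != i].
have [|u' hu' fu'] := IH w'.
  move=> j; rewrite mem_filter => /andP[ji /ws]; rewrite inE (negPf ji) //.
have szw : (size w' + e = size w)%N by rewrite size_filter addnC count_predC.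
have ne : [seq j <- w | j == i] = nseq e i.
  by have /all_pred1P := filter_all (pred1 i) w; rewrite size_filter.
have pw : perm_eq w (nseq e i ++ w').
  by rewrite -ne perm_sym (perm_filterC (pred1 i)).
exists (g i ^+ e * u'); last first.
  have -> : word g w - g i ^+ e * u' =
      (word g w - word g (nseq e i ++ w')) + word g (nseq e i) * (word g w' - u').
    by rewrite word_cat mulrBr addrA subrK /word big_nseq iter_mulr_1.
  apply: lspanD; first exact: word_perm.
  by rewrite -szw addnC -{1}(size_nseq e i); exact: filt_wordMl.
have ew : (e <= size w)%N by rewrite -szw leq_addl.
exists (fun j => if j == e then u' else 0).
exists (fun j v => if j == e then monom w' v else 0); split=> [j jw||v].
- case: eqP => [->|_]; last exact: normal_form_zero.
  by rewrite -szw addnK.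
- rewrite (bigD1 (Ordinal (ew : (e < (size w).+1)%N))) //= eqxx big1 ?addr0 // => j.
  by rewrite -val_eqE /= => /negPf ->; rewrite mulr0.
- rewrite (bigD1 (Ordinal (ew : (e < (size w).+1)%N))) //= eqxx big1 ?addr0 => [|j].
    by rewrite /monom (perm_big _ pw) big_cat /= big_nseq iter_mulr_1.
  by rewrite -val_eqE /= => /negPf ->; rewrite mulr0.
Qed.

(** Sorting the words of length d changes u only by shorter words and leaves p
unchanged; the sorted combination is determined by p. *)
Lemma has_symbol_eq0 d u p : has_symbol g d u p -> (forall v, p v = 0) -> filt g d u.
Proof.
move=> h p0; suff [u' [q [hu' fu' qE]]] : exists u' q,
    [/\ normal_form (enum I) d u' q, filt g d (u - u') & q =1 p].
  have u'0 : u' = 0.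
    by apply: normal_form_eq0 (enum_uniq I) hu' _ => v; rewrite qE.
  by rewrite u'0 subr0 in fu'.
elim: h => {u p p0} [p p0|c w u p q wd _ [u' [p' [hu' fu' p'E]]] qE].
  exists 0, (fun=> 0); split=> //; first exact: normal_form_zero.
  by rewrite subrr; exact: lspan0.
case: (eqVneq (size w) d) wd qE hu' fu' => [<- _|wNd wd] qE hu' fu'; last first.
  exists u', p'; split=> [//||v]; last by rewrite qE add0r.
  by rewrite -addrA; apply: lspanP => //; apply: filt_word; rewrite ltn_neqAle wNd.
have [|x hx fx] := @word_normal_form (enum I) w; first by move=> i; rewrite mem_enum.
exists (c *: x + u'), (fun v => c * monom w v + p' v); split=> [||v].
- exact: normal_formP.
- by rewrite opprD addrACA -scalerBr; apply: lspanP.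
- by rewrite qE p'E.
Qed.

End NormalForm.

(** * Functionals computing symbols *)

Section Separation.
Variables (k : fieldType) (I : finType) (A : algType k) (g : I -> A).

(** lam n reads off the value at v of the symbol in degree n. *)
Definition separated : Prop := forall v : point k I, exists lam : nat -> A -> k^o,
  (forall n, linear (lam n)) /\
  forall n w, (size w <= n)%N ->
    lam n (word g w) = if size w == n then monom w v else 0.

(** In degree d the functional lam d sends an element to the value at v of any of
its symbols. *)
Lemma symbol_eq0 d p : separated -> has_symbol g d 0 p -> forall v, p v = 0.
Proof.
move=> sep h v; have [lam [laml lamE]] := sep v.
have lam0 : lam d 0 = 0 by exact: linear_fun0.
suff lamp u q : has_symbol g d u q -> lam d u = q v by rewrite -(lamp _ _ h).
elim=> [r r0|c w u' r r' wd _ IH r'E]; first by rewrite lam0 r0.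
rewrite laml lamE // IH r'E; congr (_ + _).
by case: ifP => _; rewrite ?scaler0.
Qed.

End Separation.

(** * Tensor products *)

Section TensorGenerators.
Variables (k : fieldType) (I J : finType) (A B : algType k).
Variables (g : I -> A) (h : J -> B).

(** The projection to the quotient by the span of pure tensors and the zero map
agree on pure tensors, hence are equal. *)
Lemma tensor_span (u : A ⊗[k] B) : lspan (fun x => exists a b, x = a ⊗ b) u.
Proof.
set S := fun x => _; rewrite -[u]subr0; apply/lpi_eqP.
have -> : lpi S 0 = 0 by exact: linear0.
move: u; apply: tensor_linear_ext => [c x y|c x y|a b].
- exact: linearP.
- by rewrite scaler0 addr0.
- by rewrite (@lpi_gen _ _ S (a ⊗ b)) ?linear0 //; exists a, b.
Qed.

Lemma tensor_multiplicative (C : algType k) (f : A ⊗[k] B -> C) : linear f ->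
  (forall a b a' b', f ((a ⊗ b) * (a' ⊗ b')) = f (a ⊗ b) * f (a' ⊗ b')) ->
  {morph f : x y / x * y}.
Proof.
move=> fl fM x y.
have f0 : f 0 = 0 by exact: linear_fun0.
elim: (tensor_span x) => [|_ [a [b ->]]|c x1 x2 _ IH1 _ IH2].
- by rewrite mul0r f0 mul0r.
- elim: (tensor_span y) => [|_ [a' [b' ->]]|c y1 y2 _ IH1 _ IH2] //.
    by rewrite mulr0 f0 mulr0.
  by rewrite mulr_linear_l !fl IH1 IH2 mulr_linear_l.
- by rewrite mulr_linear_r !fl IH1 IH2 mulr_linear_r.
Qed.

Definition tensor_gen (x : I + J) : A ⊗[k] B :=
  match x with inl i => g i ⊗ 1 | inr j => 1 ⊗ h j end.

Definition lefts (w : seq (I + J)) : seq I :=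
  pmap (fun x => if x is inl i then Some i else None) w.
Definition rights (w : seq (I + J)) : seq J :=
  pmap (fun x => if x is inr j then Some j else None) w.

Lemma size_lefts_rights w : (size (lefts w) + size (rights w) = size w)%N.
Proof. by elim: w => [|[i|j] w IH] //=; rewrite ?addSn ?addnS IH. Qed.

Lemma word_tensor_gen w : word tensor_gen w = word g (lefts w) ⊗ word h (rights w).
Proof.
elim: w => [|[i|j] w IH]; first by rewrite /word !big_nil tens11.
  by rewrite word_cons IH tensM mul1r /= word_cons.
by rewrite word_cons IH tensM mul1r /= word_cons.
Qed.

Lemma filt_tens m n a b : filt g m.+1 a -> filt h n.+1 b ->
  filt tensor_gen (m + n).+1 (a ⊗ b).
Proof.
move=> fa fb; apply: (@lspan_map _ _ _ _ _ (fun x => x ⊗ b) _ _ _ fa) => [|_ [w wm ->]].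
  exact: tensPl.
apply: (@lspan_map _ _ _ _ _ (fun x => _ ⊗ x) _ _ _ fb) => [|_ [w' wn ->]].
  exact: tensPr.
apply: lspan_gen; exists (map inl w ++ map inr w').
  by rewrite size_cat !size_map ltnS leq_add.
rewrite word_tensor_gen /lefts /rights !pmap_cat.
suff [-> [-> [-> ->]]] : pmap (fun x : I + J => if x is inl i then Some i else None)
      (map inl w) = w /\ pmap (fun x : I + J => if x is inl i then Some i else None)
      (map inr w') = [::] /\ pmap (fun x : I + J => if x is inr i then Some i else None)
      (map inl w) = [::] /\ pmap (fun x : I + J => if x is inr i then Some i else None)
      (map inr w') = w' by rewrite cats0.
by do !split; [elim: w {wm}|elim: w' {wn}|elim: w {wm}|elim: w' {wn}] => //= ? ? ->.
Qed.

Lemma tensor_gen_comm :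
  (forall i i', filt g 2 (g i * g i' - g i' * g i)) ->
  (forall j j', filt h 2 (h j * h j' - h j' * h j)) ->
  forall x y, filt tensor_gen 2 (tensor_gen x * tensor_gen y - tensor_gen y * tensor_gen x).
Proof.
move=> cg ch [i|j] [i'|j'] /=; rewrite !tensM ?mulr1 ?mul1r ?subrr; try exact: lspan0.
  have -> : (g i * g i') ⊗ 1 - (g i' * g i) ⊗ 1 = (g i * g i' - g i' * g i) ⊗ 1 :> A ⊗[k] B.
    by rewrite addrC -scaleN1r -tensPl scaleN1r addrC.
  by apply: (@filt_tens 1 0) => //; exact: filt1.
have -> : 1 ⊗ (h j * h j') - 1 ⊗ (h j' * h j) = 1 ⊗ (h j * h j' - h j' * h j) :> A ⊗[k] B.
  by rewrite addrC -scaleN1r -tensPr scaleN1r addrC.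
by apply: (@filt_tens 0 1) => //; exact: filt1.
Qed.

Lemma tensor_gen_generates :
  (forall a, exists n, filt g n a) -> (forall b, exists n, filt h n b) ->
  forall u, exists n, filt tensor_gen n u.
Proof.
move=> gg gh u; elim: (tensor_span u) => [|_ [a [b ->]]|c x y _ [m fx] _ [n fy]].
- by exists 0%N; exact: lspan0.
- have [[m fa] [n fb]] := (gg a, gh b); exists (m + n).+1.
  by apply: filt_tens; [exact: filtW fa|exact: filtW fb].
- by exists (maxn m n); apply: lspanP; [exact: filtW (leq_maxl _ _) fx|exact: filtW (leq_maxr _ _) fy].
Qed.

Definition lpoint (v : point k (I + J)%type) : point k I := [ffun i => v (inl i)].
Definition rpoint (v : point k (I + J)%type) : point k J := [ffun j => v (inr j)].

Lemma monom_tensor w v : monom w v = monom (lefts w) (lpoint v) * monom (rights w) (rpoint v).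
Proof.
rewrite /monom; elim: w => [|[i|j] w IH]; first by rewrite !big_nil mul1r.
  by rewrite big_cons IH /= big_cons ffunE mulrA.
by rewrite big_cons IH /= big_cons ffunE mulrCA.
Qed.

(** The functional of degree n is the sum of lam m (x) mu (n - m) over m.  A word
of length at most n splits into a left word and a right word, and unless m is
the length of the left one, one of the two factors sees a word shorter than its
degree and vanishes. *)
Lemma tensor_gen_separated : separated g -> separated h -> separated tensor_gen.
Proof.
move=> sg sh v.
have [lam [laml lamE]] := sg (lpoint v); have [mu [mul muE]] := sh (rpoint v).
pose f n m (a : A) (b : B) : k^o := lam n a * mu m b.
have fl n m b : linear (f n m ^~ b).
  by move=> c a a'; rewrite /f laml mulrDl -scalerAl.
have fr n m a : linear (f n m a).
  by move=> c b b'; rewrite /f mul mulrDr -scalerAr.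
exists (fun n u => \sum_(m < n.+1) tlift (f m (n - m)%N) u); split=> [n c x y|n w wn].
  rewrite scaler_sumr -big_split; apply: eq_bigr => m _ /=.
  exact: (tlift_linear (fl _ _) (fr _ _)).
have sz := size_lefts_rights w.
pose l := size (lefts w).
have ln : (l < n.+1)%N by rewrite ltnS; apply: leq_trans wn; rewrite -sz leq_addr.
have rn : (size (rights w) <= n - l)%N by rewrite leq_subRL // sz.
rewrite word_tensor_gen (bigD1 (Ordinal ln)) //= big1 ?addr0 => [|m ml].
  rewrite (tliftE (fl _ _) (fr _ _)) /f lamE // eqxx muE // -sz monom_tensor.
  have -> : (size (rights w) == n - l)%N = (size (lefts w) + size (rights w) == n)%N.
    by rewrite -[in RHS](subnKC (ln : (l <= n)%N)) eqn_add2l.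
  by case: ifP => _; rewrite ?mulr0.
rewrite (tliftE (fl _ _) (fr _ _)) /f; case: (ltngtP l m) => [lm|lm|/esym lm].
- by rewrite lamE ?(ltnW lm) // (ltn_eqF lm) mul0r.
- have rm : (size (rights w) < n - m)%N.
    by apply: leq_ltn_trans rn _; rewrite ltn_sub2l // (leq_trans lm).
  by rewrite muE ?(ltnW rm) // (ltn_eqF rm) mulr0.
- by move: ml; rewrite -val_eqE /= lm eqxx.
Qed.

End TensorGenerators.

Lemma tmap_multiplicative (k : fieldType) (A B C D : algType k)
    (f : {linear A -> C}) (g : {linear B -> D}) :
  {morph f : x y / x * y} -> {morph g : x y / x * y} ->
  {morph tmap f g : x y / x * y}.
Proof.
move=> fM gM; apply: tensor_multiplicative; first exact: tmap_linear.
by move=> a b a' b'; rewrite tensM !tmapE fM gM tensM.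
Qed.

Lemma tflip_multiplicative (k : fieldType) (A B : algType k) :
  {morph @tflip k A B : x y / x * y}.
Proof.
apply: tensor_multiplicative; first exact: tflip_linear.
by move=> a b a' b'; rewrite tensM !tflipE tensM.
Qed.

Section SymbolLemmas.
Variables (k : fieldType) (I : finType) (A : algType k) (g : I -> A).

Lemma has_symbol_gen i : has_symbol g 1 (g i) (fun v => v i).
Proof.
have := has_symbol_word g [:: i]; rewrite /word big_seq1.
by apply: has_symbol_ext => v; rewrite /monom big_seq1.
Qed.

Lemma has_symbolD d u p u' p' : has_symbol g d u p -> has_symbol g d u' p' ->
  has_symbol g d (u + u') (fun v => p v + p' v).
Proof.
move=> h h'; have := has_symbolP 1 h h'; rewrite scale1r.
by apply: has_symbol_ext => v; rewrite mul1r.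
Qed.

Lemma has_symbolB d u p u' p' : has_symbol g d u p -> has_symbol g d u' p' ->
  has_symbol g d (u - u') (fun v => p v - p' v).
Proof.
move=> h h'; have := has_symbolP (-1) h' h; rewrite scaleN1r addrC.
by apply: has_symbol_ext => v; rewrite mulN1r addrC.
Qed.

End SymbolLemmas.

(** * Generation of the enveloping algebra *)

Section Subalgebra.
Variables (k : fieldType) (A : algType k) (S : {pred A}).
Hypothesis S_closed : subalg_closed S.

(** A name carrying the closure proof, so that the closedness structure can be
attached to an arbitrary predicate. *)
Definition subalg_pred of subalg_closed S : {pred A} := S.

HB.instance Definition _ :=
  GRing.isSubalgClosed.Build k A (subalg_pred S_closed) S_closed.

Record subalg := Subalg { subalg_val : A; _ : subalg_val \in subalg_pred S_closed }.

HB.instance Definition _ := [isSub for subalg_val].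
HB.instance Definition _ := [Choice of subalg by <:].
HB.instance Definition _ := [SubChoice_isSubAlgebra of subalg by <:].

End Subalgebra.

(** By the universal property delta -> S extends to a morphism from U(delta) to
the subalgebra S; followed by the inclusion it fixes the generators, so it is
the identity and every element lies in S. *)
Lemma uea_generated (k : fieldType) (L : finLieAlgType k) (S : {pred uea L}) :
  subalg_closed S -> (forall x : L, uea_in x \in S) -> forall u, u \in S.
Proof.
move=> Scl Sin; pose f (x : L) : subalg Scl := Subalg (Sin x : _ \in subalg_pred Scl).
have f_lie : lie_hom f.
  have [il ib] := @uea_in_lie_hom k L.
  by split=> [c x y|x y]; apply: val_inj; rewrite /= ?il ?ib.
pose psi : {lrmorphism uea L -> uea L} := HB.pack (val \o uea_lift f)
  (GRing.isLinear.Build k (uea L) (uea L) *:%R (val \o uea_lift f)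
     (fun c x y => congr1 val (uea_lift_linear f_lie c x y)))
  (GRing.isMonoidMorphism.Build (uea L) (uea L) (val \o uea_lift f)
     (conj (congr1 val (uea_lift_monoid_morphism f_lie).1)
        (fun x y => congr1 val ((uea_lift_monoid_morphism f_lie).2 x y)))).
have psi_id : psi =1 idfun.
  by apply: uea_ext => x; rewrite /= (uea_lift_in f_lie).
by move=> u; rewrite -[u]psi_id; exact: (valP (uea_lift f u)).
Qed.

(** * The counit *)

Section Counit.
Variables (k : fieldType) (L : finLieAlgType k).

Definition counit : uea L -> k^o := uea_lift (fun _ => 0 : k^o).

Lemma zero_lie_hom : lie_hom (fun _ : L => 0 : k^o).
Proof. by split=> [c x y|x y]; rewrite ?scaler0 ?mulr0 ?subr0 ?addr0. Qed.

Lemma counit_linear : linear counit.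
Proof. exact: (uea_lift_linear zero_lie_hom). Qed.

Lemma counit1 : counit 1 = 1.
Proof. exact: (uea_lift_monoid_morphism zero_lie_hom).1. Qed.

Lemma counit_in x u : counit (uea_in x * u) = 0.
Proof.
rewrite /counit (uea_lift_monoid_morphism zero_lie_hom).2.
by rewrite (uea_lift_in zero_lie_hom) mul0r.
Qed.

End Counit.

(** * A basis of the image of the Lie algebra *)

Section DualBasis.
Variables (k : fieldType) (L : finLieAlgType k).
Local Notation H := (uea L).
Local Notation counit := (@counit k L).

(** The functionals live on the whole enveloping algebra and kill 1: this is what
makes them act on it with lower order. *)
Definition dual_family n (b : 'I_n -> L) (e : 'I_n -> H -> k^o) : Prop :=
  [/\ forall i, linear (e i), forall i, e i 1 = 0 &
      forall i j, e i (uea_in (b j)) = (i == j)%:R].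

Definition in_family n (b : 'I_n -> L) (e : 'I_n -> H -> k^o) (x : L) : Prop :=
  uea_in x = \sum_i e i (uea_in x) *: uea_in (b i).

Lemma uea_in_linear : linear (@uea_in k L).
Proof. by have [] := @uea_in_lie_hom k L. Qed.

Lemma dual_family_coord n (b : 'I_n -> L) e (c : 'I_n -> k) i : dual_family b e ->
  e i (\sum_j c j *: uea_in (b j)) = c i.
Proof.
case=> el _ eb; rewrite linear_fun_sum //.
rewrite (bigD1 i) //= linear_funZ // eb eqxx big1 ?addr0 => [|j ji].
  by rewrite /GRing.scale /= mulr1.
by rewrite linear_funZ // eb eq_sym (negPf ji) scaler0.
Qed.

Lemma in_familyP n (b : 'I_n -> L) e : dual_family b e -> forall a x y,
  in_family b e x -> in_family b e y -> in_family b e (a *: x + y).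
Proof.
move=> [el e1 eb] a x y hx hy; rewrite /in_family uea_in_linear {1}hx {1}hy.
rewrite scaler_sumr -big_split; apply: eq_bigr => i _ /=.
by rewrite el scalerDl scalerA.
Qed.

(** Gram-Schmidt: a vector outside the span so far is corrected to x', killed
by the previous functionals, and a functional f with f(x') = 1 is corrected to
f', killing the previous vectors and 1. *)
Lemma exists_dual_family_seq (s : seq L) : exists n (b : 'I_n -> L) e,
  dual_family b e /\ forall x, x \in s -> in_family b e x.
Proof.
elim: s => [|x s [n [b [e [be IH]]]]].
  exists 0%N, (fun=> 0), (fun _ _ => 0); split=> //.
  by split=> [i||]; [case: i => [[]] | case=> [[]] | case=> [[]]].
have [hx|hx] := pselect (in_family b e x).
  exists n, b, e; split=> // y; rewrite inE => /predU1P[->//|]; exact: IH.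
have [el e1 eb] := be.
pose x' : L := x - \sum_i (e i (uea_in x) : k) *: b i.
have x'E : uea_in x' = uea_in x - \sum_i e i (uea_in x) *: uea_in (b i).
  rewrite (linear_funB uea_in_linear) (linear_fun_sum _ _ uea_in_linear).
  by congr (_ - _); apply: eq_bigr => i _; rewrite (linear_funZ _ uea_in_linear).
have x'0 : uea_in x' <> 0.
  by move=> x'0; apply: hx; apply/eqP; rewrite -subr_eq0 -x'E x'0.
have ex' i : e i (uea_in x') = 0.
  by rewrite x'E linear_funB // dual_family_coord // subrr.
have [f [fl fx']] := exists_normalized_form x'0.
have epsx (y : L) : counit (uea_in y) = 0 by rewrite -[uea_in y]mulr1 counit_in.
pose f' (u : H) : k^o := f u - \sum_i e i u * f (uea_in (b i)) - counit u * f 1.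
have f'l : linear f'.
  move=> c u v; rewrite /f' fl counit_linear.
  have -> : \sum_i e i (c *: u + v) * f (uea_in (b i)) =
      c * \sum_i e i u * f (uea_in (b i)) + \sum_i e i v * f (uea_in (b i)).
    rewrite mulr_sumr -big_split; apply: eq_bigr => i _ /=.
    by rewrite el mulrDl -scalerAl.
  by rewrite /GRing.scale /=; ring.
have f'1 : f' 1 = 0.
  rewrite /f' big1 ?subr0 => [|i _]; last by rewrite e1 mul0r.
  by rewrite counit1 mul1r subrr.
have f'b i : f' (uea_in (b i)) = 0.
  rewrite /f' (bigD1 i) //= eb eqxx mul1r big1 => [|j ji].
    by rewrite epsx mul0r subr0 addr0 subrr.
  by rewrite eb (negPf ji) mul0r.
have f'x' : f' (uea_in x') = 1.
  rewrite /f' fx' epsx mul0r subr0 big1 ?subr0 // => i _.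
  by rewrite ex' mul0r.
pose b2 i := if unlift ord0 i is Some j then b j else x'.
pose e2 (i : 'I_n.+1) := if unlift ord0 i is Some j then e j else f'.
have be2 : dual_family b2 e2.
  split=> [i|i|i j]; rewrite /e2 /b2.
  - by case: unliftP.
  - by case: unliftP.
  - case: (unliftP ord0 i) => [i'|] ->; case: (unliftP ord0 j) => [j'|] ->.
    + by rewrite eb (inj_eq lift_inj).
    + by rewrite ex' lift_eqF.
    + by rewrite f'b eq_liftF.
    + by rewrite f'x' eqxx.
have e2E u : \sum_i e2 i u *: uea_in (b2 i) =
    f' u *: uea_in x' + \sum_i e i u *: uea_in (b i).
  rewrite big_ord_recl /e2 /b2 unlift_none; congr (_ + _).
  by apply: eq_bigr => i _; rewrite liftK.
exists n.+1, b2, e2; split=> // y; rewrite inE => /predU1P[->|ys].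
  have xE : uea_in x = uea_in x' + \sum_i e i (uea_in x) *: uea_in (b i).
    by rewrite x'E subrK.
  have f'x : f' (uea_in x) = 1.
    rewrite xE linear_funD // f'x' linear_fun_sum // big1 ?addr0 // => i _.
    by rewrite linear_funZ // f'b scaler0.
  by rewrite /in_family e2E f'x scale1r.
have f'y : f' (uea_in y) = 0.
  rewrite (IH y ys) linear_fun_sum // big1 // => i _.
  by rewrite linear_funZ // f'b scaler0.
by rewrite /in_family e2E f'y scale0r add0r; exact: IH.
Qed.

Lemma exists_dual_family : exists n (b : 'I_n -> L) e,
  dual_family b e /\ forall x, in_family b e x.
Proof.
have [n [b [e [be bs]]]] := exists_dual_family_seq (vbasis {:L}).
exists n, b, e; split=> // x; rewrite (coord_vbasis (memvf x)).
elim/big_rec: _ => [|i y _ IH].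
  rewrite /in_family (linear_fun0 uea_in_linear).
  have [el _ _] := be.
  by rewrite big1 // => i _; rewrite linear_fun0 // scale0r.
by apply: in_familyP => //; apply/bs/mem_nth; rewrite size_tuple.
Qed.

End DualBasis.

(** * The action of functionals on the enveloping algebra *)

Section Contraction.
Variables (k : fieldType) (L : finLieAlgType k).
Local Notation H := (uea L).
Local Notation counit := (@counit k L).

Definition contract (xi : H -> k^o) : H ⊗[k] H -> H :=
  tlift (fun a b => xi a *: b).

Lemma contract_bilin_l (xi : H -> k^o) (b : H) : linear xi -> linear (fun a : H => xi a *: b).
Proof. by move=> xl c x y; rewrite xl scalerDl -scalerA. Qed.

Lemma contract_bilin_r (xi : H -> k^o) (a : H) : linear (fun b : H => xi a *: b).
Proof. by move=> c x y; rewrite scalerDr !scalerA mulrC. Qed.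

Lemma contractE xi a b : linear xi -> contract xi (a ⊗ b) = xi a *: b.
Proof.
move=> xl; apply: (tliftE (f := fun a b => xi a *: b)) => [b'|a'].
  exact: contract_bilin_l.
exact: contract_bilin_r.
Qed.

Lemma contract_linear xi : linear xi -> linear (contract xi).
Proof.
move=> xl; apply: tlift_linear => [b'|a']; first exact: contract_bilin_l.
exact: contract_bilin_r.
Qed.

(** The action (xi (x) id) o Delta of the convolution algebra of functionals. *)
Definition dual_act (xi : H -> k^o) (u : H) : H := contract xi (coproduct u).

Lemma dual_act_linear xi : linear xi -> linear (dual_act xi).
Proof. by move=> xl c u v; rewrite /dual_act linearP contract_linear. Qed.

Lemma dual_act1 xi : linear xi -> dual_act xi 1 = xi 1 *: 1.
Proof. by move=> xl; rewrite /dual_act rmorph1 -tens11 contractE. Qed.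

Lemma shift_linear xi (a : H) : linear xi -> linear (fun u : H => xi (a * u) : k^o).
Proof. by move=> xl c x y; rewrite mulrDr -scalerAr xl. Qed.

(** From Delta (x u) = (x (x) 1 + 1 (x) x) Delta u. *)
Lemma dual_act_inM xi x u : linear xi ->
  dual_act xi (uea_in x * u) =
  dual_act (fun a => xi (uea_in x * a)) u + uea_in x * dual_act xi u.
Proof.
move=> xl; have sl := shift_linear (uea_in x) xl.
rewrite /dual_act rmorphM /= coproductE; move: (coproduct u).
apply: tensor_linear_ext => [c y z|c y z|a b].
- by rewrite mulrDr -scalerAr contract_linear.
- by rewrite !contract_linear // mulrDr scalerDr -scalerAr addrACA.
rewrite mulrDl !tensM !mul1r linear_funD; last exact: contract_linear.
by rewrite !contractE // -scalerAr.
Qed.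

Lemma dual_actP c xi eta u : linear xi -> linear eta ->
  dual_act (fun a => c * xi a + eta a) u = c *: dual_act xi u + dual_act eta u.
Proof.
move=> xl el; rewrite /dual_act; move: (coproduct u).
have sl : linear (fun a => c * xi a + eta a : k^o).
  by move=> b x y; rewrite xl el /GRing.scale /=; ring.
apply: tensor_linear_ext => [b y z|b y z|a b].
- exact: contract_linear.
- by rewrite !contract_linear // !scalerDr !scalerA [b * c]mulrC addrACA.
by rewrite !contractE // scalerDl scalerA.
Qed.

Section Generators.
Variables (n : nat) (b : 'I_n -> L) (e : 'I_n -> H -> k^o).
Hypothesis be : dual_family b e.
Hypothesis b_spans : forall x, in_family b e x.

Local Notation g := (fun i => uea_in (b i)).

(** The counit axiom, obtained word by word: the functional counit (x * _)
vanishes, so dual_act counit commutes with left multiplication by generators. *)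
Lemma dual_act_counit_word w : dual_act counit (word g w) = word g w.
Proof.
have cl := @counit_linear k L.
elim: w => [|i w IH]; first by rewrite /word big_nil dual_act1 // counit1 scale1r.
rewrite word_cons dual_act_inM // IH -[RHS]add0r; congr (_ + _).
rewrite /dual_act; move: (coproduct _).
have sl := shift_linear (uea_in (b i)) cl.
apply: tensor_linear_ext => [|c x y|a a']; first exact: contract_linear.
  by rewrite scaler0 addr0.
by rewrite contractE // counit_in scale0r.
Qed.

Lemma dual_act_counit u m : filt g m u -> dual_act counit u = u.
Proof.
have dl := dual_act_linear (@counit_linear k L).
elim=> [|_ [w _ ->]|a x y _ IHx _ IHy]; first exact: linear_fun0.
  exact: dual_act_counit_word.
by rewrite dl IHx IHy.
Qed.

(** Leibniz rule up to the action of a functional eta killing 1, which lowers the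
degree.  The functional xi (g i * _) of dual_act_inM takes the value xi (g i)
at 1, so it is xi (g i) times the counit plus eta. *)
Lemma dual_act_gen_leading xi i u m : linear xi -> filt g m u ->
  exists2 eta : H -> k^o, linear eta /\ eta 1 = 0 &
    dual_act xi (g i * u) = xi (g i) *: u + g i * dual_act xi u + dual_act eta u.
Proof.
move=> xl fu; have sl := shift_linear (g i) xl.
pose eta a : k^o := - xi (g i) * counit a + xi (g i * a).
exists eta.
  split=> [c x y|]; last by rewrite /eta mulr1 counit1 mulr1 addNr.
  by rewrite /eta sl (@counit_linear k L) /GRing.scale /=; ring.
rewrite dual_act_inM // (dual_actP _ _ (@counit_linear k L) sl) (dual_act_counit fu).
by rewrite scaleNr addrACA addrN add0r addrC.
Qed.

(** The induction must run over all functionals killing 1, since the Leibniz rule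
replaces xi by another one. *)
Lemma dual_act_filt xi u m : linear xi -> xi 1 = 0 -> filt g m.+1 u ->
  filt g m (dual_act xi u).
Proof.
move=> xl x1; suff dw w : forall xi, linear xi -> xi 1 = 0 ->
    filt g (size w) (dual_act xi (word g w)).
  apply: lspan_map => [|_ [w wm ->]]; first exact: dual_act_linear.
  by apply: filtW (dw w xi xl x1).
elim: w => [|i w IH] {xl x1 u} {}xi xl x1.
  by rewrite /word big_nil dual_act1 // x1 scale0r; exact: lspan0.
rewrite word_cons.
have fw : filt g (size w).+1 (word g w) by exact: filt_word.
have [eta [el e1] ->] := dual_act_gen_leading i xl fw.
apply: lspanD; last by apply: filtW (IH eta el e1).
by apply: lspanD; [exact: lspanZ | apply: filt_genMl; exact: IH].
Qed.

Section Iterate.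
Variable xi : H -> k^o.
Hypotheses (xl : linear xi) (x1 : xi 1 = 0).

Lemma iter_dual_act_linear m : linear (iter m (dual_act xi)).
Proof.
by elim: m => [|m IH] c x y //=; rewrite IH dual_act_linear.
Qed.

Lemma iter_dual_act_eq0 m u : filt g m u -> iter m (dual_act xi) u = 0.
Proof.
elim: m u => [|m IH] u fu; first exact: filt0 fu.
by rewrite iterSr IH //; exact: dual_act_filt.
Qed.

(** As for the (m+1)-st derivative of a product of a linear function with a
polynomial of degree m: exactly one of the m+1 differentiations
must fall on the linear factor. *)
Lemma iter_dual_act_gen m i u : filt g m.+1 u ->
  iter m.+1 (dual_act xi) (g i * u) = (m.+1%:R * xi (g i)) *: iter m (dual_act xi) u.
Proof.
elim: m u => [|m IH] u fu; rewrite iterSr; have [eta [el e1] ->] := dual_act_gen_leading i xl fu.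
  have /filt0 -> := dual_act_filt xl x1 fu; have /filt0 -> := dual_act_filt el e1 fu.
  by rewrite mulr0 !addr0 mul1r.
rewrite !(linear_funD (iter_dual_act_linear _)) (linear_funZ _ (iter_dual_act_linear _)).
rewrite (iter_dual_act_eq0 (dual_act_filt el e1 fu)) addr0.
rewrite (IH _ (dual_act_filt xl x1 fu)) -iterSr -scalerDl.
by congr (_ *: _); rewrite -[m.+2%:R]natr1; ring.
Qed.

Lemma iter_dual_act_word w :
  iter (size w) (dual_act xi) (word g w) = ((size w)`!%:R * \prod_(i <- w) xi (g i))%:A.
Proof.
elim: w => [|i w IH]; first by rewrite /word !big_nil mulr1 scale1r.
rewrite word_cons iter_dual_act_gen; last exact: filt_word.
by rewrite IH scalerA big_cons factS natrM; congr (_ *: _); ring.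
Qed.

End Iterate.

(** For the functional xi with values v i on the generators, the n-th iterate of
its action maps a word w of length n to n! * monom w v and kills shorter words.
Dividing by n! uses characteristic 0. *)
Lemma uea_separated : [pchar k] =i pred0 -> separated g.
Proof.
move=> /pcharf0P char0 v; have [el e1 eb] := be.
pose xi (u : H) : k^o := \sum_i (v i : k) * e i u.
have xl : linear xi.
  move=> c x y; rewrite /xi scaler_sumr -big_split; apply: eq_bigr => i _ /=.
  by rewrite el /GRing.scale /=; ring.
have x1 : xi 1 = 0 by rewrite /xi big1 // => i _; rewrite e1 mulr0.
have xg i : xi (g i) = v i.
  rewrite /xi (bigD1 i) //= eb eqxx mulr1 big1 ?addr0 // => j ji.
  by rewrite eb (negPf ji) mulr0.
exists (fun m u => (m`!%:R^-1 : k) *: counit (iter m (dual_act xi) u)); split=> [m|m w wm].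
  move=> c x y; rewrite iter_dual_act_linear // counit_linear.
  by rewrite /GRing.scale /=; ring.
case: eqP wm => [<- _|/eqP wNm wm].
  rewrite iter_dual_act_word // (linear_funZ _ (@counit_linear k L)) counit1.
  rewrite /GRing.scale /= mulr1 mulKf; last by rewrite char0 -lt0n fact_gt0.
  by apply: eq_bigr => i _; rewrite xg.
rewrite iter_dual_act_eq0 // ?(linear_fun0 (@counit_linear k L)) ?scaler0 //.
by apply: filt_word; rewrite ltn_neqAle wNm.
Qed.

Lemma uea_in_filt x : filt g 2 (uea_in x).
Proof.
rewrite b_spans; apply: lspan_sum => i _; apply: lspanZ.
by rewrite -[uea_in _]mulr1; apply: filt_genMl; exact: filt1.
Qed.

Lemma uea_gen_comm i j : filt g 2 (g i * g j - g j * g i).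
Proof.
have [_ <-] := @uea_in_lie_hom k L; exact: uea_in_filt.
Qed.

(** The elements of finite degree form a subalgebra containing delta. *)
Lemma uea_gen_generates u : exists m, filt g m u.
Proof.
pose S : {pred H} := fun u => `[< exists m, filt g m u >].
suff: u \in S by move/asboolP.
apply: uea_generated => [|x]; last by apply/asboolP; exists 2; exact: uea_in_filt.
split=> [|a x y /asboolP[m fx] /asboolP[p fy]|x y /asboolP[m fx] /asboolP[p fy]].
- by apply/asboolP; exists 1; exact: filt1.
- apply/asboolP; exists (maxn m p).
  by apply: lspanP; [exact: filtW (leq_maxl _ _) fx|exact: filtW (leq_maxr _ _) fy].
apply/asboolP; elim: fx => [|_ [w _ ->]|a x1 x2 _ [q IH1] _ [r IH2]].
- by exists 0; rewrite mul0r; exact: lspan0.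
- by exists (size w + p)%N; exact: filt_wordMl.
exists (maxn q r); rewrite mulrDl -scalerAl.
by apply: lspanP; [exact: filtW (leq_maxl _ _) IH1|exact: filtW (leq_maxr _ _) IH2].
Qed.

End Generators.
End Contraction.

(** * Components of symbols, and elements of low degree *)

Section PairPoint.
Variables (k : fieldType) (I J : finType).

Definition pair_point (x : point k I) (y : point k J) : point k (I + J)%type :=
  [ffun s => match s with inl i => x i | inr j => y j end].

Lemma lpoint_pair x y : lpoint (pair_point x y) = x.
Proof. by apply/ffunP => i; rewrite !ffunE. Qed.

Lemma rpoint_pair x y : rpoint (pair_point x y) = y.
Proof. by apply/ffunP => j; rewrite !ffunE. Qed.

Lemma pair_lrpoint v : pair_point (lpoint v) (rpoint v) = v.
Proof. by apply/ffunP => -[i|j]; rewrite !ffunE. Qed.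

Lemma monom_scale (a : k) (w : seq I) (x : point k I) :
  monom w (a *: x) = a ^+ size w * monom w x.
Proof.
rewrite /monom; elim: w => [|i w IH]; first by rewrite !big_nil mulr1.
by rewrite !big_cons IH ffunE exprS /GRing.scale /=; ring.
Qed.

End PairPoint.

Lemma polyfun_monom (k : closedFieldType) (I : finType) (w : seq I) :
  polyfun (monom w : point k I -> k).
Proof.
elim: w => [|i w IH].
  by apply: (polyfun_eq (polyfun_const 1)) => v; rewrite /monom big_nil.
have pi : polyfun (fun v : point k I => v i : k).
  move=> u v; exists ((u i : k)%:P + (v i : k) *: 'X) => t.
  by rewrite hornerD hornerC hornerZ hornerX !ffunE mulrC.
by apply: (polyfun_eq (polyfunM pi IH)) => v; rewrite /monom big_cons.
Qed.

(** The component of degree j in the second argument collects the words with j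
right letters. *)
Lemma has_symbol_bihomogeneous (k : closedFieldType) (I J : finType)
    (A : algType k) (g : I + J -> A) d u p : has_symbol g d u p ->
  exists Fj : nat -> point k I -> point k J -> k,
    [/\ forall x y, p (pair_point x y) = \sum_(j < d.+1) Fj j x y,
        forall j a b x y, (j <= d)%N ->
          Fj j (a *: x) (b *: y) = a ^+ (d - j) * b ^+ j * Fj j x y &
        forall j, polyfun (fun v : point k I * point k J => Fj j v.1 v.2)].
Proof.
elim=> {u p} [p p0|c w u p q wd _ [Fj [pE Fh Fp]] qE].
  exists (fun _ _ _ => 0); split=> [x y|*|j]; last exact: polyfun_const.
    by rewrite p0 big1.
  by rewrite mulr0.
have [wd'|wNd] := eqVneq (size w) d; last first.
  by exists Fj; split=> // x y; rewrite qE (negPf wNd) add0r.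
pose r := size (rights w).
pose M x y := c * (monom (lefts w) x * monom (rights w) y).
exists (fun j x y => (if j == r then M x y else 0) + Fj j x y).
have sz := size_lefts_rights w.
have rd : (r < d.+1)%N by rewrite ltnS -wd' -sz leq_addl.
split=> [x y|j a b x y jd|j].
- rewrite qE wd' eqxx pE big_split; congr (_ + _).
  rewrite (bigD1 (Ordinal rd)) //= eqxx big1 => [|j]; last first.
    by rewrite -val_eqE /= => /negPf ->.
  by rewrite addr0 monom_tensor lpoint_pair rpoint_pair.
- rewrite Fh // mulrDr; congr (_ + _); case: eqP => [->|_]; last by rewrite mulr0.
  have -> : (d - r = size (lefts w))%N by rewrite -wd' -sz addnK.
  by rewrite /M !monom_scale /r; ring.
- apply: polyfunD => //; case: eqP => _; last exact: polyfun_const.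
  apply: polyfunM; first exact: polyfun_const.
  by apply: polyfunM; [apply: (@polyfun_comp _ _ _ fst _ _ (polyfun_monom _)) |
                       apply: (@polyfun_comp _ _ _ snd _ _ (polyfun_monom _))].
Qed.

Section LowDegree.
Variables (k : fieldType) (I : finType) (A : algType k) (g : I -> A).

Lemma filt_exists_symbol d u : filt g d.+1 u -> exists p, has_symbol g d u p.
Proof.
elim=> [|_ [w wd ->]|a x y _ [p hp] _ [q hq]].
- by exists (fun=> 0); apply: has_symbol_zero.
- exists (fun v => (if size w == d then 1 * monom w v else 0) + 0).
  rewrite -[word g w]scale1r -[_ *: _]addr0.
  by apply: (@has_symbol_cons _ _ _ _ _ _ _ _ (fun=> 0)) => //; apply: has_symbol_zero.
- by eexists; apply: has_symbolP hp hq.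
Qed.

Lemma filt1_scalar u : filt g 1 u -> exists t : k, u = t%:A.
Proof.
elim=> [|_ [[|//] _ ->]|a x y _ [s ->] _ [t ->]].
- by exists 0; rewrite scale0r.
- by exists 1; rewrite /word big_nil scale1r.
- by exists (a * s + t); rewrite scalerDl scalerA.
Qed.

Lemma has_symbol_degree1 u p : has_symbol g 1 u p ->
  exists (t : k) (c : I -> k),
    u = t%:A + \sum_i c i *: g i /\ forall v, p v = \sum_i c i * v i.
Proof.
elim=> {u p} [p p0|a w u p q wd _ [t [c [-> pE]]] qE].
  exists 0, (fun=> 0); split=> [|v].
    by rewrite scale0r add0r big1 // => i _; rewrite scale0r.
  by rewrite p0 big1 // => i _; rewrite mul0r.
case: w wd qE => [|i [|//]] _ qE.
  exists (a + t), c; split=> [|v]; last by rewrite qE add0r.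
  by rewrite /word big_nil scalerDl addrA.
exists t, (fun j => a * (j == i)%:R + c j); split=> [|v].
  rewrite /word big_seq1 addrCA; congr (_ + _).
  under [RHS]eq_bigr do rewrite scalerDl.
  rewrite big_split /=; congr (_ + _).
  rewrite (bigD1 i) //= eqxx mulr1 big1 ?addr0 // => j /negPf ->.
  by rewrite mulr0 scale0r.
rewrite qE /= pE /monom big_seq1.
under [RHS]eq_bigr do rewrite mulrDl.
rewrite big_split /=; congr (_ + _).
rewrite (bigD1 i) //= eqxx mulr1 big1 ?addr0 // => j /negPf ->.
by rewrite mulr0 mul0r.
Qed.

End LowDegree.

(** In the least possible degree the symbol cannot vanish, as otherwise u would
have lower degree. *)
Lemma exists_minimal_symbol (k : closedFieldType) (I : finType) (A : algType k)
    (g : I -> A) m u :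
  (forall i j, filt g 2 (g i * g j - g j * g i)) -> filt g m u ->
  (exists t : k, u = t%:A) \/
  exists d p, [/\ (0 < d)%N, has_symbol g d u p & exists v, p v != 0].
Proof.
move=> comm; elim: m => [/filt0 ->|m IH fu]; first by left; exists 0; rewrite scale0r.
case: m IH fu => [_ /filt1_scalar|m IH fu]; first by left.
have [p hp] := filt_exists_symbol fu.
have [p0|p_neq0] := pselect (forall v, p v = 0).
  by apply: IH; exact: has_symbol_eq0 hp p0.
right; exists m.+1, p; split=> //; apply/not_existsP => p0; apply: p_neq0 => v.
by apply/eqP/negPn/negP; exact: p0.
Qed.

(** * The equation in the cube of the enveloping algebra *)

Section TensorAlgebra.
Variables (k : fieldType) (A B : algType k).

Lemma tensDl (a a' : A) (b : B) : (a + a') ⊗ b = a ⊗ b + a' ⊗ b.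
Proof. exact: (linear_funD (tensPl b)). Qed.
Lemma tensDr (a : A) (b b' : B) : a ⊗ (b + b') = a ⊗ b + a ⊗ b'.
Proof. exact: (linear_funD (tensPr a)). Qed.
Lemma tensZl c (a : A) (b : B) : (c *: a) ⊗ b = c *: (a ⊗ b).
Proof. exact: (linear_funZ c (tensPl b)). Qed.
Lemma tensZr c (a : A) (b : B) : a ⊗ (c *: b) = c *: (a ⊗ b).
Proof. exact: (linear_funZ c (tensPr a)). Qed.

Lemma tmap1 (C D : algType k) (f : {linear A -> C}) (g : {linear B -> D}) :
  f 1 = 1 -> g 1 = 1 -> tmap f g 1 = 1.
Proof. by move=> f1 g1; rewrite -(tens11 A B) tmapE f1 g1 tens11. Qed.

Lemma tassoc1 (C : algType k) : tassoc (1 : A ⊗[k] (B ⊗[k] C)) = 1.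
Proof. by rewrite -(tens11 A _) -(tens11 B C) tassocE !tens11. Qed.

Lemma tflip1 : tflip (1 : A ⊗[k] B) = 1.
Proof. by rewrite -(tens11 A B) tflipE tens11. Qed.

End TensorAlgebra.

Section Equation.
Variables (k : closedFieldType) (L : finLieAlgType k).
Hypothesis char0 : [pchar k] =i pred0.
Local Notation H := (uea L).
Local Notation Delta := (@coproduct k L).

Definition defect (alpha : H ⊗[k] H) : (H ⊗[k] H) ⊗[k] H :=
  (alpha ⊗ 1) * tmap Delta idfun alpha
  - tassoc (1 ⊗ alpha) * tassoc (tmap idfun Delta alpha).

(** With X2 = 1 (x) s (x) 1 and X3 = 1 (x) 1 (x) s, which commute, the defect is
(X2 + t)(X3 + t) - (X3 + t)(X2 + X3 + t) = - X3^2 - t X3: it does not involve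
the first two factors. *)
Lemma defect_solution (s : L) (t : k) :
  defect (1 ⊗ uea_in s + t%:A) =
  1 ⊗ 1 ⊗ (- (uea_in s * uea_in s) - t *: uea_in s).
Proof.
set S := uea_in s.
pose X2 : (H ⊗[k] H) ⊗[k] H := 1 ⊗ S ⊗ 1.
pose X3 : (H ⊗[k] H) ⊗[k] H := 1 ⊗ 1 ⊗ S.
have X23 : X2 * X3 = X3 * X2 by rewrite !tensM !mulr1 !mul1r.
have e1 : (1 ⊗ S + t%:A) ⊗ 1 = X2 + t%:A by rewrite tensDl tensZl tens11.
have e2 : tmap Delta idfun (1 ⊗ S + t%:A) = X3 + t%:A.
  by rewrite linearD linearZ /= tmapE tmap1 ?rmorph1 //= /X3 tens11.
have e3 : tassoc (1 ⊗ (1 ⊗ S + t%:A)) = X3 + t%:A.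
  by rewrite tensDr tensZr linearD linearZ /= tassocE /X3 !tens11 tassoc1.
have e4 : tassoc (tmap idfun Delta (1 ⊗ S + t%:A)) = X2 + X3 + t%:A.
  rewrite linearD linearZ /= tmapE tmap1 ?rmorph1 //= coproductE tensDr.
  by rewrite !linearD linearZ /= !tassocE tassoc1.
have -> : 1 ⊗ 1 ⊗ (- (S * S) - t *: S) = - (X3 * X3) - t *: X3.
  by rewrite tensDr -!scaleN1r !tensZr /X3 !tensM !mulr1.
rewrite /defect e1 e2 e3 e4 !(mulrDl, mulrDr) X23 -!scalerAl -!scalerAr.
rewrite !mulr1 !mul1r.
have cancel (V : zmodType) (a b c e q : V) :
    a + b + (c + e) - (a + q + c + (b + c + e)) = - q - c.
  rewrite [a + q + c + _](AC (3*3) ((2*3)*(1*4*(5*6)))) /=.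
  by move: (a + b + (c + e)) => x; rewrite opprD addrCA subrr addr0 opprD.
exact: cancel.
Qed.

Variables (n : nat) (b : 'I_n -> L) (e : 'I_n -> H -> k^o).
Hypothesis be : dual_family b e.
Hypothesis b_spans : forall x, in_family b e x.

Local Notation g := (fun i => uea_in (b i)).
Local Notation g2 := (tensor_gen g g).
Local Notation g3 := (tensor_gen g2 g).

Lemma has_symbol_inl (A B : algType k) (I J : finType) (f : I -> A) (h : J -> B) i :
  has_symbol (tensor_gen f h) 1 (f i ⊗ 1) (fun v => lpoint v i).
Proof.
by apply: has_symbol_ext (has_symbol_gen (tensor_gen f h) (inl i)) => v; rewrite ffunE.
Qed.

Lemma has_symbol_inr (A B : algType k) (I J : finType) (f : I -> A) (h : J -> B) j :
  has_symbol (tensor_gen f h) 1 (1 ⊗ h j) (fun v => rpoint v j).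
Proof.
by apply: has_symbol_ext (has_symbol_gen (tensor_gen f h) (inr j)) => v; rewrite ffunE.
Qed.

Local Notation xpt v := (lpoint (lpoint v)).
Local Notation ypt v := (rpoint (lpoint v)).
Local Notation zpt v := (rpoint v).

Lemma has_symbol_x i : has_symbol g3 1 (g i ⊗ 1 ⊗ 1) (fun v => xpt v i).
Proof.
apply: has_symbol_ext (has_symbol_inl g2 g (inl i)) => v.
by rewrite !ffunE.
Qed.

Lemma has_symbol_y i : has_symbol g3 1 (1 ⊗ g i ⊗ 1) (fun v => ypt v i).
Proof.
apply: has_symbol_ext (has_symbol_inl g2 g (inr i)) => v.
by rewrite !ffunE.
Qed.

Lemma has_symbol_z i : has_symbol g3 1 (1 ⊗ 1 ⊗ g i) (fun v => zpt v i).
Proof.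
rewrite tens11; exact: (has_symbol_inr g2 g i).
Qed.

(** Each of the four factors is the image of alpha under an algebra morphism;
Delta sends a generator to a sum, whose symbol is the sum of two coordinates. *)
Lemma has_symbol_defect d alpha p : has_symbol g2 d alpha p ->
  has_symbol g3 (d + d) (defect alpha) (fun v =>
    p (pair_point (xpt v) (ypt v)) * p (pair_point (xpt v + ypt v) (zpt v)) -
    p (pair_point (ypt v) (zpt v)) * p (pair_point (xpt v) (ypt v + zpt v))).
Proof.
move=> h; apply: has_symbolB; apply: has_symbolM.
- apply: (has_symbol_map (f := fun u => u ⊗ 1) (phi := fun v => pair_point (xpt v) (ypt v)) _ _ _ _ h).
  + exact: tensPl.
  + exact: tens11.
  + by move=> u v; rewrite tensM mulr1.
  case=> i; [apply: has_symbol_ext (has_symbol_x i)|apply: has_symbol_ext (has_symbol_y i)];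
    by move=> v; rewrite [RHS]ffunE.
- apply: (has_symbol_map (phi := fun v => pair_point (xpt v + ypt v) (zpt v)) _ _ _ _ h).
  + exact: tmap_linear.
  + by rewrite tmap1 // rmorph1.
  + by apply: tmap_multiplicative => // u v; exact: rmorphM.
  case=> i; rewrite /= tmapE /=.
    rewrite coproductE tensDl.
    by apply: has_symbol_ext (has_symbolD (has_symbol_x i) (has_symbol_y i)) => v; rewrite [RHS]ffunE [RHS]ffunE.
  rewrite rmorph1 -tens11.
  by apply: has_symbol_ext (has_symbol_z i) => v; rewrite [RHS]ffunE.
- apply: (has_symbol_map (f := fun u => tassoc (1 ⊗ u)) (phi := fun v => pair_point (ypt v) (zpt v)) _ _ _ _ h).
  + by move=> c u v; rewrite tensPr linearP.
  + by rewrite tens11 tassoc1.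
  + by move=> u v; rewrite -tassocM tensM mulr1.
  case=> i; rewrite /= tassocE.
    by apply: has_symbol_ext (has_symbol_y i) => v; rewrite [RHS]ffunE.
  by apply: has_symbol_ext (has_symbol_z i) => v; rewrite [RHS]ffunE.
- apply: (has_symbol_map (f := fun u => tassoc (tmap idfun Delta u)) (phi := fun v => pair_point (xpt v) (ypt v + zpt v)) _ _ _ _ h).
  + by move=> c u v; rewrite tmap_linear linearP.
  + by rewrite tmap1 // ?rmorph1 // tassoc1.
  + move=> u v; rewrite tmap_multiplicative ?tassocM // => x y; exact: rmorphM.
  case=> i; rewrite /= tmapE /=.
    rewrite rmorph1 -tens11 tassocE.
    by apply: has_symbol_ext (has_symbol_x i) => v; rewrite [RHS]ffunE.
  rewrite coproductE tensDr linearD /= !tassocE.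
  by apply: has_symbol_ext (has_symbolD (has_symbol_y i) (has_symbol_z i)) => v; rewrite [RHS]ffunE [RHS]ffunE.
Qed.

Lemma has_symbol_flip d (u : (H ⊗[k] H) ⊗[k] H) p : has_symbol g3 d u p ->
  has_symbol g3 d (tmap (@tflip k H H) idfun u)
    (fun v => p (pair_point (pair_point (ypt v) (xpt v)) (zpt v))).
Proof.
apply: has_symbol_map.
- exact: tmap_linear.
- by apply: tmap1 => //; exact: tflip1.
- by apply: tmap_multiplicative => //; exact: tflip_multiplicative.
case=> [[i|i]|i]; rewrite /= tmapE /= ?tflipE.
- by apply: has_symbol_ext (has_symbol_y i) => v; rewrite [RHS]ffunE [RHS]ffunE.
- by apply: has_symbol_ext (has_symbol_x i) => v; rewrite [RHS]ffunE [RHS]ffunE.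
- rewrite tflip1 -(tens11 H H).
  by apply: has_symbol_ext (has_symbol_z i) => v; rewrite [RHS]ffunE.
Qed.

Lemma g3_separated : separated g3.
Proof.
have sep := uea_separated be char0.
by apply: tensor_gen_separated => //; exact: tensor_gen_separated.
Qed.

Lemma symbol_equation d alpha p : has_symbol g2 d alpha p ->
  defect alpha = tmap (@tflip k H H) idfun (defect alpha) ->
  let F x y := p (pair_point x y) in forall x y z,
  (F x y - F y x) * F (x + y) z = F y z * F x (y + z) - F x z * F y (x + z).
Proof.
move=> h eq_defect F x y z.
have hd := has_symbol_defect h.
have := has_symbolB hd (has_symbol_flip hd); rewrite -eq_defect subrr.
move=> /(symbol_eq0 g3_separated)/(_ (pair_point (pair_point x y) z)).
rewrite !(lpoint_pair, rpoint_pair) -!/(F _ _) [y + x]addrC => e0.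
apply/eqP; rewrite -subr_eq0 -e0; apply/eqP; ring.
Qed.

(** Unless alpha is a scalar, its symbol in least degree is nonzero and satisfies
the equation, hence has degree 1 and involves only the right coordinates. *)
Lemma defect_symmetric_solution alpha :
  defect alpha = tmap (@tflip k H H) idfun (defect alpha) ->
  exists (s : L) (t : k), alpha = 1 ⊗ uea_in s + t%:A.
Proof.
move=> eq_defect; have [il _] := @uea_in_lie_hom k L.
have comm2 := tensor_gen_comm (uea_gen_comm b_spans) (uea_gen_comm b_spans).
have gen2 := tensor_gen_generates (uea_gen_generates b_spans) (uea_gen_generates b_spans).
have [m fm] := gen2 alpha.
have [[t ->]|[d [p [d0 hp [v0 pv0]]]]] := exists_minimal_symbol comm2 fm.
  exists 0, t; rewrite (linear_fun0 il) (linear_fun0 (@tensPr k H H 1)) add0r //.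
pose F x y := p (pair_point x y).
have F_eqn := symbol_equation hp eq_defect.
have [Fj [FE Fh Fp]] := has_symbol_bihomogeneous hp.
have F0 : exists x y, F x y != 0.
  by exists (lpoint v0), (rpoint v0); rewrite /F pair_lrpoint.
have d1 : d = 1%N.
  apply/eqP; rewrite eqn_leq d0 andbT.
  exact: (symbol_degree_le1 char0 FE Fh Fp F_eqn F0).
subst d.
have Fx0 x : F x 0 = 0 by exact: (symbol_r0 char0 FE Fh Fp F_eqn F0).
have [t [c [-> pE]]] := has_symbol_degree1 hp.
have c0 i : c (inl i) = 0.
  (* evaluate F(x, 0) = 0 at the i-th basis vector *)
  have := Fx0 [ffun j => (j == i)%:R]; rewrite /F pE big_sumType /=.
  rewrite [X in _ + X]big1 ?addr0 => [|j _]; last by rewrite !ffunE mulr0.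
  rewrite (bigD1 i) //= !ffunE eqxx mulr1 big1 ?addr0 // => j ji.
  by rewrite !ffunE (negPf ji) mulr0.
exists (\sum_i c (inr i) *: b i), t; rewrite addrC; congr (_ + _).
rewrite big_sumType /= big1 ?add0r => [|i _]; last by rewrite c0 scale0r.
rewrite (linear_fun_sum _ _ il) (linear_fun_sum _ _ (@tensPr k H H 1)).
by apply: eq_bigr => i _; rewrite (linear_funZ _ il) tensZr.
Qed.

End Equation.

Theorem proposition2p2 (k : closedFieldType) (char0 : [pchar k] =i pred0)
    (delta : finLieAlgType k) (alpha : uea delta ⊗[k] uea delta) :
  let defect : (uea delta ⊗[k] uea delta) ⊗[k] uea delta :=
    (alpha ⊗ 1) * tmap (@coproduct k delta) idfun alpha
    - tassoc (1 ⊗ alpha) * tassoc (tmap idfun (@coproduct k delta) alpha) in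
  defect = tmap (@tflip k (uea delta) (uea delta)) idfun defect
  <-> exists (s : delta) (t : k), alpha = 1 ⊗ uea_in s + t%:A ⊗ 1.
Proof.
have tE (t : k) : t%:A ⊗ 1 = t%:A :> uea delta ⊗[k] uea delta by rewrite tensZl tens11.
split=> [eq_defect|[s [t ->]]].
  have [n [b [e [be b_spans]]]] := exists_dual_family delta.
  have [s [t ->]] := defect_symmetric_solution char0 be b_spans eq_defect.
  by exists s, t; rewrite tE.
rewrite -/(defect _) tE defect_solution tmapE.
by rewrite /= tens11 tflip1.
Qed.
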